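(* Let $F^m=(M,M',F^{\ast})$ be a pseudo-Finsler manifold, let $HM'$ be a nonlinear connection on $M'$ with associate almost complex structure $J$, and let $S$ and $T$ be any two skew-symmetric Finsler tensor fields of type $(1,2)$ on $F^m$. Then there exists a unique linear connection $\nabla$ on the vertical vector bundle $VM'$ satisfying the following conditions: (i) $\nabla$ is a metric connection, i.e. $\nabla_X g=0$ for all $X\in\Gamma(TM')$; (ii) the torsion $T^{\mathcal{D}}$ of the linear connection $\mathcal{D}_XY=\nabla_X vY-J\nabla_X JhY$ on $M'$ satisfies, for all $X,Y\in\Gamma(TM')$, (a) $T^{\mathcal{D}}(vX,vY)=S(vX,vY)$, (b) $hT^{\mathcal{D}}(hX,hY)=J\,T(JhX,JhY)$.
   Context: Let $M$ be a real $m$-dimensional smooth manifold, $\pi:TM\to M$ its tangent bundle with zero section $\theta$, and $M'\subset TM$ a nonempty open submanifold with $\pi(M')=M$ and $\theta(M)\cap M'=\varnothing$, with induced local coordinates $(x^i,y^i)$. A pseudo-Finsler manifold $F^m=(M,M',F^{\ast})$ is given by a smooth function $F^{\ast}:M'\to\mathbb{R}$ that is positively homogeneous of degree two in $y$, i.e. $F^{\ast}(x,ky)=k^2F^{\ast}(x,y)$ for $k>0$ (whenever both sides are defined), and such that $g_{ij}=\frac12\frac{\partial^2F^{\ast}}{\partial y^i\partial y^j}$ are at each point the components of a quadratic form on $\mathbb{R}^m$ with $q$ negative and $m-q$ positive eigenvalues, $0<q<m$. $VM'=\ker(\pi_{\ast}|_{TM'})$ is the vertical vector bundle, locally spanned by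 $\frac{\partial}{\partial y^i}$; $g$ denotes the pseudo-Riemannian metric on $VM'$ with $g(\frac{\partial}{\partial y^i},\frac{\partial}{\partial y^j})=g_{ij}$. A nonlinear connection is a distribution $HM'$ with $TM'=HM'\oplus VM'$; it is locally spanned by $\frac{\delta}{\delta x^i}=\frac{\partial}{\partial x^i}-N^j_i(x,y)\frac{\partial}{\partial y^j}$. $h$ and $v$ are the projections of $TM'$ onto $HM'$ and $VM'$. The associate almost complex structure to $HM'$ is the bundle map $J:TM'\to TM'$ with $J(\frac{\delta}{\delta x^i})=-\frac{\partial}{\partial y^i}$, $J(\frac{\partial}{\partial y^i})=\frac{\delta}{\delta x^i}$. A linear connection on $VM'$ is a covariant derivative $\nabla_XU\in\Gamma(VM')$ for $X\in\Gamma(TM')$, $U\in\Gamma(VM')$. A skew-symmetric Finsler tensor field of type $(1,2)$ is a skew-symmetric $C^\infty(M')$-bilinear map $\Gamma(VM')\times\Gamma(VM')\to\Gamma(VM')$. The torsion is $T^{\mathcal{D}}(X,Y)=\mathcal{D}_XY-\mathcal{D}_YX-[X,Y]$. Here $\Gamma(E)$ denotes the smooth sections of a vector bundle $E$. *)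

(* Defs.v *)
From HB Require Import structures.
Set Warnings "-notation-overridden,-notation-incompatible-prefix".
From mathcomp Require Import all_boot all_order all_algebra.
From mathcomp Require Import all_classical all_reals all_analysis.

Set Implicit Arguments.
Unset Strict Implicit.
Unset Printing Implicit Defensive.

Import Order.TTheory GRing.Theory Num.Theory.
Import numFieldTopology.Exports numFieldNormedType.Exports.

Local Open Scope classical_set_scope.
Local Open Scope ring_scope.

(* [f] is of class C^k on the open set [V]: iterated partial derivatives up to
   order [k] exist and are continuous at every point of [V]. *)
Fixpoint Ck (R : realType) (n k : nat) (V : set 'rV[R]_n) (f : 'rV[R]_n -> R) :
    Prop :=
  (forall z, V z -> {for z, continuous f}) /\
  if k is k'.+1 then
    forall i : 'I_n,
      (forall z, V z -> derivable (f : _ -> R^o) z (delta_mx 0 i)) /\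
      Ck k' V (fun z => 'D_(delta_mx 0 i) (f : _ -> R^o) z)
  else True.

Definition Cinfty (R : realType) (n : nat) (V : set 'rV[R]_n)
  (f : 'rV[R]_n -> R) : Prop := forall k, Ck k V f.

(* The bare data of a family of charts; the values of [chart_coord a] outside [chart_dom a]
   are irrelevant. *)
Record atlas (R : realType) (n : nat) (T : Type) := Atlas {
  chart_index : Type;
  chart_dom : chart_index -> set T;
  chart_coord : chart_index -> T -> 'rV[R]_n }.

Section Charts.
Variables (R : realType) (n : nat) (T : Type) (A : atlas R n T).

(* The topology determined by the charts. *)
Definition aopen (O : set T) : Prop :=
  forall a : chart_index A, open (chart_coord a @` (O `&` chart_dom a)).

(* The local expression [f \o (chart_coord a)^-1] (extended by 0). *)
Definition local_expr (a : chart_index A) (f : T -> R) (z : 'rV[R]_n) : R :=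
  xget 0 [set f p | p in [set p | chart_dom a p /\ chart_coord a p = z]].

Definition smooth_on (O : set T) (f : T -> R) : Prop :=
  forall a : chart_index A,
    Cinfty (chart_coord a @` (O `&` chart_dom a)) (local_expr a f).

Definition smooth_near (p : T) (f : T -> R) : Prop :=
  exists O, [/\ aopen O, O p & smooth_on O f].

Definition smooth (f : T -> R) : Prop := forall p, smooth_near p f.

(* Tangent vectors at [p] are the operators [\sum_i y_i d/dx^i] on functions
   that are smooth near [p].  They are extended by 0 to all functions, so that
   two tangent vectors are equal as soon as they agree on smooth functions. *)
Definition vect := (T -> R) -> R.

Definition dir_deriv (a : chart_index A) (p : T) (y : 'rV[R]_n) : vect :=
  fun f => if `[< smooth_near p f >]
           then 'D_y (local_expr a f : _ -> R^o) (chart_coord a p) else 0.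

Definition tangent (p : T) (w : vect) : Prop :=
  exists a : chart_index A, exists y, chart_dom a p /\ w = dir_deriv a p y.

Definition partial (a : chart_index A) (i : 'I_n) (p : T) : vect :=
  dir_deriv a p (delta_mx 0 i).

Definition field := T -> vect.

Definition act (X : field) (f : T -> R) : T -> R := fun p => X p f.

Definition fscale (f : T -> R) (X : field) : field := fun p => f p \*o X p.

Definition vfield_on (O : set T) (X : field) : Prop :=
  (forall p, O p -> tangent p (X p)) /\
  (forall p f, O p -> smooth_near p f -> smooth_near p (act X f)).

Definition vfield : field -> Prop := vfield_on setT.

Definition bracket (X Y : field) : field :=
  fun p f => if `[< smooth_near p f >]
             then X p (act Y f) - Y p (act X f) else 0.

(* Smooth distributions of rank [k], by local frames. *)
Definition distribution (k : nat) (H : T -> set vect) : Prop :=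
  forall p, exists O (X : 'I_k -> field),
    [/\ aopen O, O p, forall i, vfield_on O (X i) &
        forall q, O q ->
          H q = [set \sum_i (c i \*o X i q) | c in [set: 'I_k -> R]] /\
          (forall c : 'I_k -> R, \sum_i (c i \*o X i q) = 0 ->
             forall i, c i = 0)].

End Charts.

(* The differential of [phi] at [p], extended by 0 like all tangent vectors. *)
Definition differential_at (R : realType) (n' : nat) (T T' : Type)
    (B : atlas R n' T') (phi : T -> T') (p : T) (w : vect R T) : vect R T' :=
  fun f => if `[< smooth_near B (phi p) f >] then w (f \o phi) else 0.

(* The charts are homeomorphisms onto open sets of R^m; [coord_smooth] says that
   the transition maps are smooth. *)
Record manifold (R : realType) (m : nat) := Manifold {
  carrier :> topologicalType;
  charts : atlas R m carrier;
  manifold_hausdorff : hausdorff_space carrier;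
  manifold_second_countable : @second_countable carrier;
  dom_cover : forall p, exists a : chart_index charts, chart_dom a p;
  dom_open : forall a : chart_index charts, open (chart_dom a);
  coord_inj : forall (a : chart_index charts) p q,
    chart_dom a p -> chart_dom a q -> chart_coord a p = chart_coord a q -> p = q;
  coord_continuous : forall (a : chart_index charts) p,
    chart_dom a p -> {for p, continuous (chart_coord a)};
  coord_open : forall (a : chart_index charts) (O : set carrier),
    open O -> O `<=` chart_dom a -> open (chart_coord a @` O);
  coord_smooth : forall (b : chart_index charts) i,
    smooth_on charts (chart_dom b) (fun p => chart_coord b p 0 i) }.

Section TangentBundle.
Variables (R : realType) (m : nat) (M : manifold R m).

Record tangent_bundle := TangentPoint {
  base : M;
  vec : vect R M;
  vecP : tangent (charts M) base vec }.

(* The induced coordinates (x, y), where [y^i = v(x^i)] at the point (x, v). *)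
Definition tangent_charts : atlas R (m + m) tangent_bundle :=
  @Atlas R (m + m) tangent_bundle (chart_index (charts M))
    (fun a => [set p | chart_dom a (base p)])
    (fun a p => row_mx (chart_coord a (base p))
                       (\row_i vec p (fun x => chart_coord a x 0 i))).

Variable M' : set tangent_bundle.

Definition sub_charts : atlas R (m + m) M' :=
  @Atlas R (m + m) M' (chart_index (charts M))
    (fun a => [set p | @chart_dom _ _ _ tangent_charts a (val p)])
    (fun a p => @chart_coord _ _ _ tangent_charts a (val p)).

Local Notation A' := sub_charts.

Definition pi_M (p : M') : M := base (val p).

Definition d_dx (a : chart_index A') (i : 'I_m) : field R M' :=
  partial (A := A') a (lshift m i).

Definition d_dy (a : chart_index A') (i : 'I_m) : field R M' :=
  partial (A := A') a (rshift m i).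

Definition g_mx (F : M' -> R) (a : chart_index A') (p : M') : 'M[R]_m :=
  \matrix_(i, j) (2^-1 * d_dy a i p (act (d_dy a j) F)).

(* [G] has [q] negative and [m - q] positive eigenvalues, counted with
   multiplicity. *)
Definition has_index (q : nat) (G : 'M[R]_m) : Prop :=
  exists d : 'I_m -> R,
    [/\ char_poly G = \prod_i ('X - (d i)%:P),
        #|[pred i | d i < 0]| = q & #|[pred i | 0 < d i]| = (m - q)%N].

Record pseudo_finsler (q : nat) (F : M' -> R) : Prop := PseudoFinsler {
  pf_index : (0 < q < m)%N;
  pf_nonempty : M' !=set0;
  pf_open : aopen tangent_charts M';
  pf_onto : forall x : M, exists p : M', pi_M p = x;
  pf_no_zero : forall p : tangent_bundle, M' p -> vec p <> 0;
  pf_smooth : smooth A' F;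
  pf_homogeneous : forall (k : R) (p p' : M'), 0 < k ->
    base (val p') = base (val p) -> vec (val p') = k \*o vec (val p) ->
    F p' = k ^+ 2 * F p;
  pf_signature : forall (a : chart_index A') (p : M'), chart_dom a p ->
    has_index q (g_mx F a p) }.

(* The fibre at [p] of [VM' = ker d(pi)]. *)
Definition vertical (p : M') (w : vect R M') : Prop :=
  tangent A' p w /\ differential_at (charts M) pi_M p w = 0.

Definition vsection (U : field R M') : Prop :=
  vfield A' U /\ forall p, vertical p (U p).

(* [g] is the fibre metric on [VM'] with components (g_ij); it is determined on
   vertical vectors, and its values elsewhere are irrelevant.  The same remark
   applies to [J] in [associate_acs] and tangent vectors. *)
Record vertical_metric (F : M' -> R) (g : M' -> vect R M' -> vect R M' -> R) :
    Prop := VerticalMetric {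
  vm_linear_l : forall p c u u' w,
    vertical p u -> vertical p u' -> vertical p w ->
    g p (c \*o u + u') w = c * g p u w + g p u' w;
  vm_linear_r : forall p c u w w',
    vertical p u -> vertical p w -> vertical p w' ->
    g p u (c \*o w + w') = c * g p u w + g p u w';
  vm_frame : forall (a : chart_index A') p i j, chart_dom a p ->
    g p (d_dy a i p) (d_dy a j p) = g_mx F a p i j }.

Record nonlinear_connection (H : M' -> set (vect R M')) : Prop :=
    NonlinearConnection {
  nc_distribution : distribution A' m H;
  nc_sum : forall p w, tangent A' p w ->
    exists u u', [/\ H p u, vertical p u' & w = u + u'];
  nc_direct : forall p w, H p w -> vertical p w -> w = 0 }.

(* A fibrewise map applied to a field. *)
Definition fibrewise (B : M' -> vect R M' -> vect R M') (X : field R M') :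
  field R M' := fun p => B p (X p).

Section Connection.
Variable H : M' -> set (vect R M').

Definition hproj (p : M') (w : vect R M') : vect R M' :=
  xget 0 [set u | H p u /\ vertical p (w - u)].

Definition vproj (p : M') (w : vect R M') : vect R M' := w - hproj p w.

(* [hproj] of [d/dx^i] is the horizontal vector of the form
   [d/dx^i - N^j_i d/dy^j]. *)
Definition delta_dx (a : chart_index A') (i : 'I_m) : field R M' :=
  fibrewise hproj (d_dx a i).

Record associate_acs (J : M' -> vect R M' -> vect R M') : Prop :=
    AssociateACS {
  acs_tangent : forall p w, tangent A' p w -> tangent A' p (J p w);
  acs_linear : forall p c u w, tangent A' p u -> tangent A' p w ->
    J p (c \*o u + w) = c \*o J p u + J p w;
  acs_smooth : forall X, vfield A' X -> vfield A' (fibrewise J X);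
  acs_delta : forall (a : chart_index A') i p, chart_dom a p ->
    J p (delta_dx a i p) = - d_dy a i p;
  acs_dy : forall (a : chart_index A') i p, chart_dom a p ->
    J p (d_dy a i p) = delta_dx a i p }.

End Connection.

(* Operators on sections are functions on all [field]s, constrained on genuine
   sections only. *)
Record skew_finsler_tensor (S : field R M' -> field R M' -> field R M') :
    Prop := SkewFinslerTensor {
  ft_vsection : forall U W, vsection U -> vsection W -> vsection (S U W);
  ft_add_l : forall U U' W, vsection U -> vsection U' -> vsection W ->
    S (U + U') W = S U W + S U' W;
  ft_add_r : forall U W W', vsection U -> vsection W -> vsection W' ->
    S U (W + W') = S U W + S U W';
  ft_scale_l : forall f U W, smooth A' f -> vsection U -> vsection W ->
    S (fscale f U) W = fscale f (S U W);
  ft_scale_r : forall f U W, smooth A' f -> vsection U -> vsection W ->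
    S U (fscale f W) = fscale f (S U W);
  ft_skew : forall U W, vsection U -> vsection W -> S U W = - S W U }.

Record linear_connection (nabla : field R M' -> field R M' -> field R M') :
    Prop := LinearConnection {
  lc_vsection : forall X U, vfield A' X -> vsection U -> vsection (nabla X U);
  lc_add_l : forall X Y U, vfield A' X -> vfield A' Y -> vsection U ->
    nabla (X + Y) U = nabla X U + nabla Y U;
  lc_scale_l : forall f X U, smooth A' f -> vfield A' X -> vsection U ->
    nabla (fscale f X) U = fscale f (nabla X U);
  lc_add_r : forall X U W, vfield A' X -> vsection U -> vsection W ->
    nabla X (U + W) = nabla X U + nabla X W;
  lc_leibniz : forall f X U, smooth A' f -> vfield A' X -> vsection U ->
    nabla X (fscale f U) = fscale f (nabla X U) + fscale (act X f) U }.

(* The covariant derivative [(nabla_X g)(U, W)]. *)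
Definition nabla_metric (g : M' -> vect R M' -> vect R M' -> R)
    (nabla : field R M' -> field R M' -> field R M') (X U W : field R M')
    (p : M') : R :=
  X p (fun q => g q (U q) (W q))
    - g p (nabla X U p) (W p) - g p (U p) (nabla X W p).

Definition metric_connection (g : M' -> vect R M' -> vect R M' -> R)
    (nabla : field R M' -> field R M' -> field R M') : Prop :=
  forall X U W, vfield A' X -> vsection U -> vsection W ->
    forall p, nabla_metric g nabla X U W p = 0.

Definition Dconn (H : M' -> set (vect R M')) (J : M' -> vect R M' -> vect R M')
    (nabla : field R M' -> field R M' -> field R M') (X Y : field R M') :
    field R M' :=
  nabla X (fibrewise (vproj H) Y) - fibrewise J (nabla X (fibrewise J (fibrewise (hproj H) Y))).

Definition torsion (D : field R M' -> field R M' -> field R M')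
    (X Y : field R M') : field R M' :=
  D X Y - D Y X - bracket A' X Y.

End TangentBundle.

(* Main.v *)
Require Import Defs.
From HB Require Import structures.
Set Warnings "-notation-overridden,-notation-incompatible-prefix".
From mathcomp Require Import all_boot all_order all_algebra.
From mathcomp Require Import all_classical all_reals all_analysis.
From mathcomp Require Import ring lra.

Set Implicit Arguments.
Unset Strict Implicit.
Unset Printing Implicit Defensive.

Import Order.TTheory GRing.Theory Num.Theory.
Import numFieldTopology.Exports numFieldNormedType.Exports.

Local Open Scope classical_set_scope.
Local Open Scope ring_scope.

(** Both torsion conditions have the same shape.  On the vertical bundle consider a
    bracket [B] with an anchor [rho] into vector fields, i.e. a skew map with
    [B(U, fW) = f B(U, W) + (rho(U) f) W].  Koszul's formula shows that there is a
    unique metric operator [D_U W], differentiating along [rho(U)], such that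
    [D_U W - D_W U = B(U, W)].  Condition (a) is this statement for [rho = id] and
    [B(U, W) = [U, W] + S(U, W)].  Since [J] identifies vertical and horizontal
    vectors, condition (b) is this statement for [rho = J] and
    [B(U, W) = T(U, W) - J h [J U, J W]].  As [X = v X + J(- J h X)], the two operators
    add up to [nabla_X U = D1_{v X} U + D2_{- J h X} U].  That Koszul's formula defines
    a section (it is only given on global sections) requires bump functions. *)

(** * Functions of class C^k on R^n *)

(** The two torsion conditions do not interact because [D] preserves both [VM'] and [HM']. As [VM']
    is integrable, the torsion on vertical pairs is vertical and (a) can prescribe all of it. On
    horizontal pairs the vertical part of the torsion is [- v[hX, hY]] for every [nabla], so (b)
    prescribes the horizontal part only. Hence (a) constrains [nabla] along vertical directions, (b)
    along horizontal ones, and the metric condition splits in the same way, by linearity in the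
    direction. Solving Koszul's formula for [D_U W] needs [g] symmetric and nondegenerate. Symmetry
    of [g_ij] is the equality of mixed partial derivatives of [F]; nondegeneracy holds because the
    two eigenvalue counts of the signature add up to [m]. Since vectors are operators on functions,
    even the linearity of a directional derivative in its direction has to come from
    differentiability; hence the elementary calculus (C^1 implies differentiable, Schwarz, chain
    rule). *)

HB.lock Definition pd (R : realType) (n : nat) (i : 'I_n)
    (f : 'rV[R]_n -> R) : 'rV[R]_n -> R :=
  fun z => 'D_(delta_mx 0 i) (f : _ -> R^o) z.

Lemma pdE (R : realType) (n : nat) (i : 'I_n) (f : 'rV[R]_n -> R) z :
  'D_(delta_mx 0 i) (f : _ -> R^o) z = pd i f z.
Proof. by rewrite pd.unlock. Qed.

Section PD.
Context {R : realType} {n : nat}.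
Implicit Types (f g : 'rV[R]_n -> R) (z : 'rV[R]_n).


(* The condition [Ck] localised at a point, so that it only depends on the germ of [f]. *)
Fixpoint ck_at (k : nat) z f : Prop :=
  (\forall z' \near z, {for z', continuous f}) /\
  if k is k'.+1 then
    forall i : 'I_n,
      (\forall z' \near z, derivable (f : _ -> R^o) z' (delta_mx 0 i)) /\
      ck_at k' z (pd i f)
  else True.

Lemma CkS k (V : set 'rV[R]_n) f :
  Ck k.+1 V f = ((forall z, V z -> {for z, continuous f}) /\
    forall i : 'I_n,
      (forall z, V z -> derivable (f : _ -> R^o) z (delta_mx 0 i)) /\
      Ck k V (pd i f)).
Proof. by rewrite pd.unlock. Qed.

(** The bridge between the definition of smoothness and germs, on which all the calculus is done. An
    open [V] is a neighbourhood of each of its points, so conditions on [V] hold near each of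
    them. *)
Lemma CkP k (V : set 'rV[R]_n) f : open V ->
  Ck k V f <-> forall z, V z -> ck_at k z f.
Proof.
move=> oV; have nV z : V z -> nbhs z V by move=> Vz; exact: open_nbhs_nbhs.
elim: k f => [|k IH] f; last rewrite CkS /=.
  split=> [[cf _] z Vz|h]; first by split=> //; apply: filterS (nV _ Vz).
  by split=> // z Vz; have [/nbhs_singleton] := h z Vz.
split=> [[cf df] z Vz|h].
  split; first exact: filterS (nV _ Vz).
  move=> i; have [dfi Dfi] := df i.
  by split; [exact: filterS (nV _ Vz)|exact: (proj1 (IH _) Dfi)].
split=> [z Vz|i]; first by have [/nbhs_singleton] := h z Vz.
split=> [z Vz|]; first by have [_ /(_ i)[/nbhs_singleton]] := h z Vz.
by apply/IH => z Vz; have [_ /(_ i)[]] := h z Vz.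
Qed.

Lemma ck_atW k z f : ck_at k.+1 z f -> ck_at k z f.
Proof.
elim: k f => [|k IH] f; first by case.
by move=> [cf df]; split=> // i; have [? /IH] := df i.
Qed.

Lemma ck_at_le k l z f : (k <= l)%N -> ck_at l z f -> ck_at k z f.
Proof.
by elim: l => [|l IH]; [rewrite leqn0 => /eqP->|
  rewrite leq_eqVlt => /predU1P[->//|/IH kl /ck_atW/kl]].
Qed.

Lemma near_eq_pd i z f g : (\forall z' \near z, f z' = g z') ->
  pd i f z = pd i g z.
Proof. by move=> fg; rewrite -!pdE; apply: near_eq_derive. Qed.

Lemma near_eq_continuous_for z f g : (\forall z' \near z, f z' = g z') ->
  {for z, continuous f} -> {for z, continuous g}.
Proof.
move=> fg cf; rewrite /prop_for /continuous_at -(nbhs_singleton fg).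
apply: cvg_trans cf; apply: (@near_eq_cvg _ _ (nbhs z)).
by apply: filterS fg => x /esym.
Qed.

(** Functions that agree near [z] also agree near every [z'] close to [z] ([near_join]), so their
    partial derivatives agree near [z] and the induction on [k] goes through. *)
Lemma ck_at_eq k z f g : (\forall z' \near z, f z' = g z') ->
  ck_at k z f -> ck_at k z g.
Proof.
have H f' g' : (\forall z' \near z, f' z' = g' z') ->
    (\forall z' \near z, {for z', continuous f'}) ->
    \forall z' \near z, {for z', continuous g'}.
  move=> /near_join fg cf; near=> z'.
  by apply: (@near_eq_continuous_for _ f'); near: z'.
elim: k f g => [|k IH] f g fg /= [cf df]; split => //; try exact: H fg cf.
move=> i; have [dfi Dfi] := df i; move: (fg) => /near_join fg2; split.
  near=> z'; have fgz : \near z', f z' = g z' by near: z'.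
  by apply: near_eq_derivable fgz _; near: z'.
apply: IH Dfi; near=> z'; apply: near_eq_pd; by near: z'.
Unshelve. all: by end_near.
Qed.

Lemma ck_at_near k z f : ck_at k z f -> \forall z' \near z, ck_at k z' f.
Proof.
elim: k f => [|k IH] f /=.
  by move=> [/near_join cf _]; near=> z'; split=> //; near: z'.
move=> [/near_join cf df].
near=> z'; split; first by near: z'.
near: z'; apply: filter_forall => i; have [/near_join dfi /IH Dfi] := df i.
by near=> z'; split; near: z'.
Unshelve. all: by end_near.
Qed.

Lemma is_derive_line f (w v : 'rV[R]_n) (t : R) :
  derivable (f : _ -> R^o) (w + t *: v) v ->
  is_derive t (1 : R) ((fun s : R => f (w + s *: v)) : R -> R^o)
    ('D_v (f : _ -> R^o) (w + t *: v)).
Proof.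
move=> df.
have E : (fun h : R => h^-1 *: (((fun s : R => f (w + s *: v) : R^o) \o shift t)
    (h *: (1 : R)) - f (w + t *: v) : R^o)) =
  (fun h => h^-1 *: (((f : _ -> R^o) \o shift (w + t *: v)) (h *: v) - f (w + t *: v))).
  apply/funext => h /=; congr (_ *: (f _ - _)).
  by rewrite [_ *: 1]mulr1 scalerDl addrCA.
by split; rewrite /derivable /derive E.
Qed.

(** Here [t] stands for a coordinate of a displacement and may be negative; locating [s] only by its
    absolute value covers both signs. *)
Lemma MVT_line f (w v : 'rV[R]_n) (t : R) :
  (forall s, `|s| <= `|t| -> derivable (f : _ -> R^o) (w + s *: v) v) ->
  exists2 s, `|s| <= `|t| &
    f (w + t *: v) - f w = t * 'D_v (f : _ -> R^o) (w + s *: v).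
Proof.
move=> df; pose g s := f (w + s *: v); pose dg s := 'D_v (f : _ -> R^o) (w + s *: v).
have dgP s : `|s| <= `|t| -> is_derive s (1 : R) (g : R -> R^o) (dg s).
  by move=> /df; exact: is_derive_line.
have cg s : `|s| <= `|t| -> {for s, continuous g}.
  move=> /dgP[+ _]; move=> /derivable1_diffP /differentiable_continuous; exact.
have E0 : g 0 = f w by rewrite /g scale0r addr0.
have [t0|t0] := leP 0 t.
- have sub s : s \in `[0, t] -> `|s| <= `|t|.
    by rewrite in_itv /= => /andP[s0 st]; rewrite !ger0_norm.
  have H1 s : s \in `]0, t[ -> is_derive s (1 : R) (g : R -> R^o) (dg s).
    by move=> /subset_itv_oo_cc /sub; exact: dgP.
  have H2 : {within `[0, t], continuous g}.
    by apply: continuous_in_subspaceT => s; rewrite inE => /sub; exact: cg.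
  have [s sI] := MVT_segment t0 H1 H2.
  rewrite E0 subr0 mulrC => E; exists s; [exact: sub|exact: E].
- have sub s : s \in `[t, 0] -> `|s| <= `|t|.
    by rewrite in_itv /= => /andP[ts s0]; rewrite !ler0_norm ?lerN2// ltW.
  have H1 s : s \in `]t, 0[ -> is_derive s (1 : R) (g : R -> R^o) (dg s).
    by move=> /subset_itv_oo_cc /sub; exact: dgP.
  have H2 : {within `[t, 0], continuous g}.
    by apply: continuous_in_subspaceT => s; rewrite inE => /sub; exact: cg.
  have [s sI] := MVT_segment (ltW t0) H1 H2.
  rewrite E0 sub0r => E; exists s; first exact: sub.
  by rewrite -/(g t) -opprB E mulrN opprK mulrC.
Qed.

(** The vertices of the path from 0 to [h] that switches on one coordinate after the other. *)
Definition trunc_row (k : nat) (h : 'rV[R]_n) : 'rV[R]_n :=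
  \row_i (if (i < k)%N then h 0 i else 0).

Lemma norm_coord_le (h : 'rV[R]_n) i : `|h 0 i| <= `|h|.
Proof.
rewrite [leRHS]/Num.Def.normr/= mx_normrE.
by apply: le_trans (le_bigmax _ _ (0, i)).
Qed.

Lemma norm_row_le (h : 'rV[R]_n) (c : R) : 0 <= c ->
  (forall i, `|h 0 i| <= c) -> `|h| <= c.
Proof.
move=> c0 hc; rewrite [leLHS]/Num.Def.normr/= mx_normrE.
by apply: bigmax_le => //= -[i j] _ /=; rewrite (ord1 i).
Qed.


Lemma trunc_rowS k (h : 'rV[R]_n) (kn : (k < n)%N) :
  trunc_row k.+1 h = trunc_row k h + h 0 (Ordinal kn) *: 'e_(Ordinal kn).
Proof.
apply/rowP => i; rewrite !mxE ltnS leq_eqVlt eqxx /=.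
have [->|ik] := eqVneq i (Ordinal kn); first by rewrite /= eqxx ltnn mulr1 add0r.
rewrite mulr0 addr0 (_ : (i == k :> nat) = false)//.
by apply/negbTE; rewrite -[k]/(nat_of_ord (Ordinal kn)) val_eqE.
Qed.

Lemma sum_truncS k (c : 'I_n -> R) (kn : (k < n)%N) :
  \sum_(i < n | (i < k.+1)%N) c i = \sum_(i < n | (i < k)%N) c i + c (Ordinal kn).
Proof.
rewrite (bigD1 (Ordinal kn)) //= addrC; congr (_ + _); apply: eq_bigl => i.
by rewrite ltnS leq_eqVlt -val_eqE /=; case: ltngtP.
Qed.

Definition pd_form f z (h : 'rV[R]_n) : R^o := \sum_i h 0 i * pd i f z.

Lemma pd_form_is_linear f z : linear (pd_form f z).
Proof.
move=> a u v; rewrite /pd_form scaler_sumr -big_split /=; apply: eq_bigr => i _.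
by rewrite !mxE mulrDl [_ *: _]mulrA.
Qed.

HB.instance Definition _ f z := GRing.isLinear.Build R 'rV[R]_n R^o *:%R
  (pd_form f z) (pd_form_is_linear f z).


Lemma pd_form_continuous f z : continuous (pd_form f z).
Proof.
move=> x; apply: (@differentiable_continuous R 'rV[R]_n R^o).
have -> : pd_form f z = \sum_i ((pd i f z : R) *: (fun h : 'rV[R]_n => h 0 i : R^o)).
  by apply/funext => h; rewrite /pd_form fct_sumE; apply: eq_bigr => i _; rewrite mulrC.
apply: differentiable_sum => i; apply: differentiableZ; exact: differentiable_coord.
Qed.

(* Change the coordinates one at a time and apply the mean value theorem to each step. *)
Lemma ck1_taylor z f : ck_at 1 z f -> forall e, 0 < e ->
  \forall h \near (0 : 'rV[R]_n), `|f (h + z) - f z - pd_form f z h| <= e * `|h|.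
Proof.
move=> [_ df] e e0.
(* There are [n] steps, each with error at most [d * |h|]; dividing by [n.+1] instead of [n] keeps
   [d] positive for [n = 0]. *)
pose d := e / n.+1%:R; have d0 : 0 < d by rewrite divr_gt0.
have : \forall z' \near z, forall i, derivable (f : _ -> R^o) z' 'e_i /\
    `|pd i f z' - pd i f z| <= d.
  apply: (@filter_forall _ _ (fun (i : 'I_n) z' => derivable (f : _ -> R^o) z' 'e_i /\
    `|pd i f z' - pd i f z| <= d) (nbhs z)) => i; have [dfi [/nbhs_singleton ci _]] := df i.
  near=> z'; split; first by near: z'.
  rewrite distrC; near: z'; move: ci => /cvgrPdist_le; exact.
move=> /nbhs_ballP[r /= r0 Hr].
apply/nbhs_ballP; exists r => // h; rewrite -ball_normE /= sub0r normrN => hr.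
have norm_trunc k : `|trunc_row k h| <= `|h|.
  apply: norm_row_le => // i; rewrite mxE; case: ifP => _; last by rewrite normr0.
  exact: norm_coord_le.
suff H k : (k <= n)%N -> `|f (z + trunc_row k h) - f z -
    \sum_(i < n | (i < k)%N) h 0 i * pd i f z| <= k%:R * d * `|h|.
  have := H n (leqnn n); rewrite (_ : trunc_row n h = h); last first.
    by apply/rowP => i; rewrite mxE ltn_ord.
  rewrite (_ : \sum_(i < n | _) _ = pd_form f z h); last first.
    by apply: eq_bigl => i; rewrite ltn_ord.
  rewrite [h + z]addrC => /le_trans; apply; apply: ler_wpM2r => //.
  by rewrite /d mulrA ler_pdivrMr // mulrC ler_pM2l // ler_nat.
elim: k => [_|k IH kn].
  rewrite big_pred0 // subr0 (_ : trunc_row 0 h = 0) ?addr0 ?subrr ?normr0 ?mul0r//.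
  by apply/rowP => i; rewrite !mxE.
rewrite (sum_truncS _ kn) (trunc_rowS _ kn).
set w := z + trunc_row k h; set i0 := Ordinal kn.
(* The norm is the maximum of the entries, so replacing the next entry of [h] by a smaller [s] keeps
   the point within [|h|] of [z], hence in the ball where the partial derivatives are controlled. *)
have wr s : `|s| <= `|h 0 i0| -> ball z r (w + s *: 'e_i0).
  move=> sh; rewrite -ball_normE /= opprD /w addrA opprD addrA subrr sub0r.
  rewrite -opprD normrN; apply: le_lt_trans hr; apply: norm_row_le => // i.
  rewrite !mxE eqxx /=; have [->|ii0] := eqVneq i i0.
    by rewrite /= ltnn add0r mulr1 (le_trans sh)// norm_coord_le.
  by rewrite mulr0 addr0; case: ifP => _; rewrite ?normr0// norm_coord_le.
have [s sh] := @MVT_line f w 'e_i0 (h 0 i0)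
  (fun s sh => (Hr _ (wr s sh) i0).1).
rewrite addrA -/w pdE => E.
have -> : f (w + h 0 i0 *: 'e_i0) - f z - (\sum_(i < n | (i < k)%N) h 0 i * pd i f z
   + h 0 i0 * pd i0 f z) = (f w - f z - \sum_(i < n | (i < k)%N) h 0 i * pd i f z) +
   h 0 i0 * (pd i0 f (w + s *: 'e_i0) - pd i0 f z).
  by move/eqP: E; rewrite subr_eq => /eqP ->; ring.
apply: le_trans (ler_normD _ _) _; rewrite -natr1 mulrDl mulrDl mul1r.
apply: lerD; first by apply: IH; exact: ltnW.
rewrite normrM mulrC; apply: ler_pM => //; last exact: norm_coord_le.
exact: (Hr _ (wr s sh) i0).2.
Unshelve. all: by end_near.
Qed.

(** The Taylor estimate is the little-o condition of a differential. This makes ['D_v f] linear in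
    [v], and thereby [dir_deriv] a combination of the [partial a i]. *)
Lemma ck1_diff z f : ck_at 1 z f ->
  is_diff z (f : _ -> R^o) (pd_form f z).
Proof.
move=> cf.
have E : (f : _ -> R^o) \o shift z = cst (f z : R^o) + pd_form f z +o_ (0 : 'rV[R]_n) id.
  apply/eqaddoP => e e0; have := ck1_taylor cf e0.
  by apply: filterS => h /=; rewrite opprD addrA.
have D : 'd (f : _ -> R^o) z = pd_form f z :> (_ -> _).
  by apply: (@diff_unique R 'rV[R]_n R^o f (pd_form f z)) => //; exact: pd_form_continuous.
split => //; apply/diff_locallyP; rewrite D; split => //; exact: pd_form_continuous.
Qed.

Lemma ck1_differentiable z f : ck_at 1 z f -> differentiable (f : _ -> R^o) z.
Proof. by move=> /ck1_diff []. Qed.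

Lemma ck1_deriveE z f v : ck_at 1 z f ->
  'D_v (f : _ -> R^o) z = \sum_i v 0 i * pd i f z.
Proof. by move=> /ck1_diff [d E]; rewrite deriveE // E. Qed.

(** The inductive step of the closure properties below: once a formula for the first derivatives is
    known near [z], only the C^k regularity of that formula is left, a matter for the induction
    hypothesis. *)
Lemma ck_atS_intro k z f (Df : 'I_n -> 'rV[R]_n -> R) :
  (\forall z' \near z, {for z', continuous f}) ->
  (forall i, \forall z' \near z,
    is_derive z' ('e_i : 'rV[R]_n) (f : _ -> R^o) (Df i z' : R^o)) ->
  (forall i, ck_at k z (Df i)) -> ck_at k.+1 z f.
Proof.
move=> cf df Dfk; split => // i; split.
  by apply: filterS (df i) => z' [].
apply: ck_at_eq (Dfk i); apply: filterS (df i) => z' [_ E].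
by rewrite -pdE E.
Qed.

Lemma ck_at_continuous k z f : ck_at k z f ->
  \forall z' \near z, {for z', continuous f}.
Proof. by case: k => [|k] []. Qed.

Lemma ck_at_is_derive k z f i : ck_at k.+1 z f ->
  \forall z' \near z,
    is_derive z' ('e_i : 'rV[R]_n) (f : _ -> R^o) (pd i f z' : R^o).
Proof. by move=> [_ /(_ i)[df _]]; apply: filterS df => z' df; split => //; exact: pdE. Qed.

Lemma ck_at_pd k z f i : ck_at k.+1 z f -> ck_at k z (pd i f).
Proof. by move=> [_ /(_ i)[]]. Qed.

Lemma ck_at_cst k z (c : R) : ck_at k z (fun=> c).
Proof.
elim: k z c => [|k IH] z c; first by split => //; near=> z'; exact: cst_continuous.
apply: (@ck_atS_intro _ _ _ (fun _ _ => 0)) => // [|i].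
  by near=> z'; exact: cst_continuous.
by near=> z'; exact: is_derive_cst.
Unshelve. all: by end_near.
Qed.

Lemma ck_at_add k z f g : ck_at k z f -> ck_at k z g ->
  ck_at k z (fun x => f x + g x).
Proof.
elim: k f g => [|k IH] f g cf cg.
  have := ck_at_continuous cf; have := ck_at_continuous cg => Cg Cf.
  by split=> //; apply: filterS2 Cf Cg => z' a b; exact: (cvgD a b).
apply: (@ck_atS_intro _ _ _ (fun i x => pd i f x + pd i g x)) => [|i|i].
- have := ck_at_continuous cf; have := ck_at_continuous cg => Cg Cf.
  by apply: filterS2 Cf Cg => z' a b; exact: (cvgD a b).
- have := ck_at_is_derive i cf; have := ck_at_is_derive i cg => Cg Cf.
  by apply: filterS2 Cf Cg => z' a b; exact: is_deriveD.
- by apply: IH; exact: ck_at_pd.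
Unshelve. all: by end_near.
Qed.

Lemma ck_at_mul k z f g : ck_at k z f -> ck_at k z g ->
  ck_at k z (fun x => f x * g x).
Proof.
elim: k f g => [|k IH] f g cf cg.
  have := ck_at_continuous cf; have := ck_at_continuous cg => Cg Cf.
  by split=> //; apply: filterS2 Cf Cg => z' a b; exact: (cvgM a b).
apply: (@ck_atS_intro _ _ _ (fun i x => f x * pd i g x + g x * pd i f x)) => [|i|i].
- have := ck_at_continuous cf; have := ck_at_continuous cg => Cg Cf.
  by apply: filterS2 Cf Cg => z' a b; exact: (cvgM a b).
- have := ck_at_is_derive i cf; have := ck_at_is_derive i cg => Cg Cf.
  by apply: filterS2 Cf Cg => z' a b; exact: is_deriveM.
- by apply: ck_at_add; apply: IH; (apply: ck_at_pd || apply: ck_atW).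
Unshelve. all: by end_near.
Qed.

(** The derivative of [1/f] is a product of [1/f], [1/f] and a derivative of [f], so induction on
    [k] with [f] fixed suffices; [f] stays nonzero near [z] by continuity. *)
Lemma ck_at_inv k z f : f z != 0 -> ck_at k z f ->
  ck_at k z (fun x => (f x)^-1).
Proof.
move=> fz; elim: k => [|k IH] cf.
  have Cf := ck_at_continuous cf.
  have nf : \forall z' \near z, f z' != 0.
    by have /nbhs_singleton cz := Cf; exact: (cvgr_neq0 _ cz fz).
  by split=> //; apply: filterS2 Cf nf => z' a b; exact: (cvgV b a).
have Cf := ck_at_continuous cf.
have nf : \forall z' \near z, f z' != 0.
  by have /nbhs_singleton cz := Cf; exact: (cvgr_neq0 _ cz fz).
apply: (@ck_atS_intro _ _ _ (fun i x => - ((f x)^-1 * (f x)^-1) * pd i f x)) => [|i|i].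
- by apply: filterS2 Cf nf => z' a b; exact: (cvgV b a).
- have df := ck_at_is_derive i cf; near=> z'.
  have fz' : f z' != 0 by near: z'.
  have [d <-] : is_derive z' ('e_i : 'rV[R]_n) (f : _ -> R^o) (pd i f z' : R^o) by near: z'.
  split; first exact: (derivableV fz' d).
  by rewrite (deriveV fz' d) /= expr2 invfM.
- have := IH (ck_atW cf) => Hinv; apply: ck_at_mul; last exact: ck_at_pd.
  have := ck_at_mul (ck_at_cst k z (-1)) (ck_at_mul Hinv Hinv).
  by apply: ck_at_eq; near=> z'; rewrite mulN1r.
Unshelve. all: by end_near.
Qed.

Lemma is_derive_coord z v j :
  is_derive z v ((fun x : 'rV[R]_n => x 0 j) : _ -> R^o) (v 0 j : R^o).
Proof.
split; first exact/diff_derivable/differentiable_coord.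
have := derive_mx (@derivable_id _ _ z v); rewrite derive_id => /matrixP/(_ 0 j).
by rewrite mxE => <-.
Qed.

Lemma ck_at_coord k z j : ck_at k z (fun x => x 0 j).
Proof.
case: k => [|k].
  by split=> //; near=> z'; exact: coord_continuous.
apply: (@ck_atS_intro _ _ _ (fun i _ => ('e_i : 'rV[R]_n) 0 j)) => [|i|i]; last exact: ck_at_cst.
  by near=> z'; exact: coord_continuous.
by near=> z'; exact: is_derive_coord.
Unshelve. all: by end_near.
Qed.

Lemma ck_at_sum k z (I : Type) (r : seq I) (P : pred I) (h : I -> 'rV[R]_n -> R) :
  (forall i, P i -> ck_at k z (h i)) ->
  ck_at k z (fun x => \sum_(i <- r | P i) h i x).
Proof.
move=> H; elim: r => [|i r IH].
  by apply: ck_at_eq (ck_at_cst k z 0); near=> x; rewrite big_nil.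
have [Pi|Pi] := boolP (P i).
  apply: ck_at_eq (ck_at_add (H i Pi) IH); near=> x; by rewrite big_cons Pi.
by apply: ck_at_eq IH; near=> x; rewrite big_cons (negbTE Pi).
Unshelve. all: by end_near.
Qed.

(* A family of functions whose derivatives are combinations of members of the family
   consists of C^oo functions. *)
Lemma ck_at_comp1 (I : Type) (J : finType) (u : I -> R -> R) (c : I -> J -> R)
    (s : I -> J -> I) :
  (forall a t, is_derive t (1 : R) (u a : R -> R^o) (\sum_b c a b * u (s a b) t)) ->
  forall k z f a, ck_at k z f -> ck_at k z (fun x => u a (f x)).
Proof.
move=> du.
have cu a : continuous (u a).
  move=> t; have [d _] := du a t.
  by move/derivable1_diffP/differentiable_continuous : d; exact.
elim=> [|k IH] z f a cf.
  have Cf := ck_at_continuous cf.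
  by split=> //; apply: filterS Cf => z' cfz; exact: (continuous_comp cfz (cu a _)).
apply: (@ck_atS_intro _ _ _ (fun i x => pd i f x * \sum_b c a b * u (s a b) (f x))) => [|i|i].
- have Cf := ck_at_continuous cf.
  by apply: filterS Cf => z' cfz; exact: (continuous_comp cfz (cu a _)).
- have := ck_at_near (ck_at_le (isT : (1 <= k.+1)%N) cf).
  apply: filterS => z' /ck1_differentiable d.
  have [/derivable1_diffP d2 E2] := du a (f z').
  have d3 := differentiable_comp d d2.
  split; first exact: diff_derivable.
  rewrite (deriveE _ d3) diff_comp //= -E2 (deriveE _ d2) -pdE (deriveE _ d).
  set t := 'd f z' 'e_i.
  by rewrite -[in LHS](mulr1 t) -[t * 1]/(t *: (1 : R)) linearZ.
- apply: ck_at_mul; first exact: ck_at_pd.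
  apply: ck_at_sum => b _; apply: ck_at_mul; first exact: ck_at_cst.
  by apply: IH; exact: ck_atW.
Qed.

Lemma is_derive_translate f (x c v : 'rV[R]_n) :
  derivable (f : _ -> R^o) (x + c) v ->
  is_derive x v ((fun y => f (y + c)) : _ -> R^o) ('D_v (f : _ -> R^o) (x + c)).
Proof.
move=> df.
have E : (fun t : R => t^-1 *: (((fun y => f (y + c) : R^o) \o shift x)
     (t *: v) - f (x + c))) =
   (fun t : R => t^-1 *: (((f : _ -> R^o) \o shift (x + c)) (t *: v) - f (x + c))).
  by apply/funext => t /=; rewrite addrA.
by split; rewrite /derivable /derive E.
Qed.

(** The second difference of [f] over a small square is symmetric in the two directions. By the mean
    value theorem, used once in each direction, it is close to [h * h] times either mixed
    derivative. *)
Lemma schwarz z f i j : ck_at 2 z f -> pd i (pd j f) z = pd j (pd i f) z.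
Proof.
move=> cf.
suff H : forall e, 0 < e -> `|pd i (pd j f) z - pd j (pd i f) z| <= e.
  apply/eqP; rewrite -subr_eq0 -normr_le0; apply/ler_addgt0Pr => e e0.
  by rewrite add0r; exact: H.
have key a b e : 0 < e -> exists2 r, 0 < r & forall h, 0 < h -> h < r ->
    `|f (z + h *: 'e_a + h *: 'e_b) - f (z + h *: 'e_a) - f (z + h *: 'e_b) + f z
      - h * h * pd b (pd a f) z| <= h * h * e.
  move=> e0.
  have [_ /(_ b)[Db [/nbhs_singleton cb _]]] : ck_at 1 z (pd a f) by exact: ck_at_pd cf.
  have [_ /(_ a)[Da _]] : ck_at 1 z f by exact: ck_atW cf.
  have : \forall z' \near z, [/\ derivable (f : _ -> R^o) z' 'e_a,
      derivable (pd a f : _ -> R^o) z' 'e_b & `|pd b (pd a f) z' - pd b (pd a f) z| <= e].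
    move: cb => /cvgrPdist_le/(_ e e0) cb.
    apply: filterS3 Da Db cb => z' p1 p2 p3; split; [exact: p1|exact: p2|].
    by rewrite distrC; exact: p3.
  (* Half of [r], because a point of the square is displaced by at most [h + h], a bound that also
     holds for [a = b]. *)
  move=> /nbhs_ballP[r /= r0 Hr]; exists (r / 2); first by rewrite divr_gt0.
  move=> h h0 hr.
  have inb s t : `|s| <= h -> `|t| <= h -> ball z r (z + s *: 'e_a + t *: 'e_b).
    move=> sh th; rewrite -ball_normE /= -addrA opprD addrA subrr sub0r normrN.
    apply: (@le_lt_trans _ _ (h + h)); last by rewrite (splitr r) ltrD.
    apply: norm_row_le => [|k]; first by rewrite addr_ge0 ?ltW.
    rewrite !mxE eqxx /=; apply: le_trans (ler_normD _ _) _; apply: lerD.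
      by case: (k == a); rewrite ?mulr1 ?mulr0 ?normr0 // ltW.
    by case: (k == b); rewrite ?mulr1 ?mulr0 ?normr0 // ltW.
  (* The second difference is the increment along [a] of this increment along [b]. *)
  pose F x := f (x + h *: 'e_b) - f x.
  have dF s : `|s| <= `|h| -> derivable (F : _ -> R^o) (z + s *: 'e_a) 'e_a /\
      'D_('e_a) (F : _ -> R^o) (z + s *: 'e_a) =
      pd a f (z + s *: 'e_a + h *: 'e_b) - pd a f (z + s *: 'e_a).
    rewrite (gtr0_norm h0) => sh.
    have hh : `|h| <= h by rewrite gtr0_norm.
    have z0h : `|0 : R| <= h by rewrite normr0 ltW.
    have [d1 _ _] := Hr _ (inb s h sh hh).
    have [d2 _ _] := Hr _ (inb s 0 sh z0h).
    rewrite scale0r addr0 in d2.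
    have [d3 E3] : is_derive (z + s *: 'e_a) 'e_a ((fun x => f (x + h *: 'e_b)) : _ -> R^o)
         (pd a f (z + s *: 'e_a + h *: 'e_b)).
      by rewrite -pdE; exact: (is_derive_translate d1).
    split; first exact: (derivableB d3 d2).
    by rewrite (deriveB d3 d2) E3 pdE.
  have [s sh Es] := MVT_line (fun s sh => (dF s sh).1).
  have {}sh' : `|s| <= h by rewrite -(gtr0_norm h0).
  have dG t : `|t| <= `|h| -> derivable (pd a f : _ -> R^o) (z + s *: 'e_a + t *: 'e_b) 'e_b.
    by rewrite (gtr0_norm h0) => th; have [] := Hr _ (inb s t sh' th).
  have [t th Et] := MVT_line dG.
  rewrite (gtr0_norm h0) in th.
  have [_ _ B] := Hr _ (inb s t sh' th).
  rewrite (dF s sh).2 Et pdE /F in Es.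
  have -> : f (z + h *: 'e_a + h *: 'e_b) - f (z + h *: 'e_a) - f (z + h *: 'e_b) + f z =
     h * (h * pd b (pd a f) (z + s *: 'e_a + t *: 'e_b)).
    by rewrite -Es opprB addrA [LHS]addrAC.
  rewrite mulrA -mulrBr normrM ger0_norm; last by rewrite mulr_ge0 ?ltW.
  by rewrite ler_pM2l // mulr_gt0.
move=> e e0; have e20 : 0 < e / 2 by rewrite divr_gt0.
have [r1 r10 H1] := key j i _ e20; have [r2 r20 H2] := key i j _ e20.
pose h := Num.min r1 r2 / 2.
have minl : Num.min r1 r2 <= r1 by rewrite ge_min lexx.
have minr : Num.min r1 r2 <= r2 by rewrite ge_min lexx orbT.
have m0 : 0 < Num.min r1 r2 by rewrite lt_min r10.
have h0 : 0 < h by rewrite divr_gt0.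
have hm : h < Num.min r1 r2 by rewrite ltr_pdivrMr // ltr_pMr // ltr1n.
have := H1 h h0 (lt_le_trans hm minl).
have := H2 h h0 (lt_le_trans hm minr).
(* The far corner of the square is reached in either order; from here on both estimates concern the
   same second difference. *)
rewrite [z + h *: 'e_i + h *: 'e_j]addrAC.
set A := f _; set B := f _; set C := f _.
move=> h2 h1; rewrite -(ler_pM2l (mulr_gt0 h0 h0)).
rewrite -[in leLHS](gtr0_norm (mulr_gt0 h0 h0)) -normrM mulrBr.
set X := _ * pd i _ _ in h1 *; set Y := _ * pd j _ _ in h2 *.
rewrite (_ : X - Y = (A - B - C + f z - Y) - (A - C - B + f z - X)); last by ring.
apply: le_trans (ler_normB _ _) _.
by rewrite (splitr e) mulrDr; exact: lerD.
Unshelve. all: by end_near.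
Qed.
End PD.

(** * The chain rule for maps between R^n and R^m *)

Section Composition.
Context {R : realType} {n m : nat}.
Implicit Types (f : 'rV[R]_m -> R) (phi : 'rV[R]_n -> 'rV[R]_m) (z : 'rV[R]_n).

Lemma row_continuous z phi :
  (forall j, {for z, continuous (fun x => phi x 0 j)}) -> {for z, continuous phi}.
Proof.
move=> H; apply/(@cvgrPdist_le _ _ _ (nbhs z)) => e e0.
have K : \forall x \near z, forall j, `|phi z 0 j - phi x 0 j| <= e.
  apply: (@filter_forall _ _ (fun (j : 'I_m) x => `|phi z 0 j - phi x 0 j| <= e) (nbhs z)) => j.
  by have /cvgrPdist_le/(_ e e0) := H j.
apply: filterS K => x Hx; apply: norm_row_le; first exact: ltW.
by move=> j; rewrite !mxE; exact: Hx.
Qed.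

Lemma row_differentiable z phi :
  (forall j, differentiable (fun x => phi x 0 j : R^o) z) -> differentiable phi z.
Proof.
move=> H; have -> : phi = \sum_(j < m) (fun x => (phi x 0 j : R) *: ('e_j : 'rV[R]_m)).
  by apply/funext => x; rewrite fct_sumE [LHS]row_sum_delta.
by apply: differentiable_sum => j; apply: differentiableZl; exact: H.
Qed.

Lemma is_derive_comp_row z phi f v :
  (forall j, ck_at 1 z (fun x => phi x 0 j)) -> ck_at 1 (phi z) f ->
  is_derive z v ((f \o phi) : _ -> R^o)
    (\sum_j 'D_v (fun x => phi x 0 j : R^o) z * pd j f (phi z)).
Proof.
move=> cphi cf.
have dphi : differentiable phi z.
  by apply: row_differentiable => j; exact: ck1_differentiable.
have dfp := ck1_differentiable cf.
have d := differentiable_comp dphi dfp.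
split; first exact: diff_derivable.
rewrite (deriveE _ d) diff_comp //= -(deriveE _ dfp) (ck1_deriveE _ cf).
apply: eq_bigr => j _; congr (_ * _).
by rewrite -(deriveE _ dphi) derive_mx ?mxE//; exact: diff_derivable.
Qed.

Lemma row_near_continuous k z phi : (forall j, ck_at k z (fun x => phi x 0 j)) ->
  \forall x \near z, {for x, continuous phi}.
Proof.
move=> cphi.
have H : \forall x \near z, forall j, {for x, continuous (fun x => phi x 0 j)}.
  apply: (@filter_forall _ _
    (fun (j : 'I_m) x => {for x, continuous (fun x => phi x 0 j)}) (nbhs z)) => j.
  exact: ck_at_continuous (cphi j).
by apply: filterS H => x Hx; apply: row_continuous.
Qed.

Lemma near_comp z phi (P : set 'rV[R]_m) : {for z, continuous phi} ->
  (\forall y \near phi z, P y) -> \forall x \near z, P (phi x).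
Proof. by move=> cz Py; apply: cz. Qed.

(** The first derivatives are sums of a derivative of [phi] times a derivative of [f] composed with
    the same [phi], so the induction hypothesis is applied to [pd j f]. *)
Lemma ck_at_comp k z phi f :
  (forall j, ck_at k z (fun x => phi x 0 j)) -> ck_at k (phi z) f ->
  ck_at k z (fun x => f (phi x)).
Proof.
move=> + +; elim: k f => [|k IH] f cphi cf.
  have Cphi := row_near_continuous cphi.
  have Cf := near_comp (nbhs_singleton Cphi) (ck_at_continuous cf).
  by split=> //; apply: filterS2 Cphi Cf => x a b; exact: (continuous_comp a b).
have Cphi := row_near_continuous cphi.
have Cf := near_comp (nbhs_singleton Cphi) (ck_at_continuous cf).
apply: (@ck_atS_intro _ _ _ _ _
  (fun i x => \sum_j pd i (fun x => phi x 0 j) x * pd j f (phi x))) => [|i|i].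
- by apply: filterS2 Cphi Cf => x a b; exact: (continuous_comp a b).
- have H1 : \forall x \near z, forall j, ck_at 1 x (fun x => phi x 0 j).
    apply: (@filter_forall _ _ (fun (j : 'I_m) x => ck_at 1 x (fun x => phi x 0 j)) (nbhs z)) => j.
    exact: ck_at_near (ck_at_le _ (cphi j)).
  have H2 : \forall x \near z, ck_at 1 (phi x) f.
    exact: (near_comp (nbhs_singleton Cphi) (ck_at_near (ck_at_le _ cf))).
  apply: filterS2 H1 H2 => x h1 h2.
  have [d E] := is_derive_comp_row 'e_i h1 h2; split; first exact: d.
  by rewrite [LHS]E; apply: eq_bigr => j _; rewrite pdE.
- apply: ck_at_sum => j _; apply: ck_at_mul; first exact: ck_at_pd (cphi j).
  apply: IH; last exact: ck_at_pd.
  by move=> j'; exact: ck_atW.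
Qed.
End Composition.

(** * A C^oo step function *)

Section Flat.
Context {R : realType}.

(* The factor [t^-j] makes the family closed under derivation. *)
Definition flat (j : nat) (t : R) : R :=
  if 0 < t then t^-1 ^+ j * expR (- t^-1) else 0.

(** With [s = 1/t], the term of degree [j.+1] of the exponential series gives
    [s^(j+1) <= (j+1)! e^s]; multiply by [t e^(-s)]. *)
Lemma flat_bound j (t : R) : `|flat j t| <= (j.+1)`!%:R * `|t|.
Proof.
rewrite /flat; case: ifPn => [t0|_]; last by rewrite normr0 mulr_ge0.
have s0 : 0 < t^-1 by rewrite invr_gt0.
rewrite ger0_norm; last by rewrite mulr_ge0 ?expR_ge0 ?exprn_ge0// ltW.
rewrite (gtr0_norm t0) expRN ler_pdivrMr ?expR_gt0//.
have E : t^-1 ^+ j.+1 / (j.+1)`!%:R <= expR t^-1.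
  by apply: le_trans (expR_ge1Dxn j (ltW s0)); rewrite lerDr.
rewrite ler_pdivrMr ?ltr0n ?fact_gt0// in E.
have := ler_wpM2l (ltW t0) E; rewrite exprS mulrA divff ?gt_eqF// mul1r.
by move=> /le_trans; apply; rewrite mulrA mulrC mulrA.
Qed.

Lemma is_derive_flat_pos j (t : R) : 0 < t ->
  is_derive t (1 : R) (flat j : R -> R^o) (flat j.+2 t - j%:R * flat j.+1 t).
Proof.
move=> t0; have tn0 : t != 0 by rewrite gt_eqF.
have dinv : is_derive t (1 : R) ((fun x : R => x^-1) : R -> R^o) (- (t ^- 2)).
  split; first exact: (derivableV tn0 (@derivable_id _ _ t 1)).
  by rewrite (deriveV tn0 (@derivable_id _ _ t 1)) derive_id [_ *: _]mulr1.
have dpow : is_derive t (1 : R) ((fun x : R => x^-1 ^+ j) : R -> R^o)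
    ((j%:R * t^-1 ^+ j.-1) * - (t ^- 2)).
  rewrite (_ : (fun x : R => x^-1 ^+ j) = (fun x : R => x^-1) ^+ j); last first.
    by apply/funext => x; rewrite fctE.
  exact: is_deriveX.
have dexp : is_derive t (1 : R) ((fun x : R => expR (- x^-1)) : R -> R^o)
    (expR (- t^-1) * t ^- 2).
  rewrite -[t ^- 2]opprK.
  have dN : is_derive t (1 : R) ((fun x : R => - x^-1) : R -> R) (- - t ^- 2).
    by have := is_deriveN dinv.
  exact: (@is_derive1_comp R (@expR R) _ t _ _ (is_derive_expR _) dN).
have E : t^-1 ^+ j * (expR (- t^-1) * t ^- 2) +
    expR (- t^-1) * ((j%:R * t^-1 ^+ j.-1) * - (t ^- 2)) =
    flat j.+2 t - j%:R * flat j.+1 t.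
  (* The exponent [j.-1] is a truncated predecessor, so [j = 0] is treated apart; there its
     coefficient vanishes. *)
  rewrite /flat t0; case: (j) => [|i].
    by rewrite !mul0r mulr0 addr0 subr0 expr0 mul1r mulrC !expr2 invfM.
  by rewrite expr2 invfM /= !exprS; ring.
have D : is_derive t (1 : R) ((fun x : R => x^-1 ^+ j * expR (- x^-1)) : R -> R^o)
    (flat j.+2 t - j%:R * flat j.+1 t).
  by rewrite -E; exact: (is_deriveM dpow dexp).
apply: near_eq_is_derive D; apply: filterS (lt_nbhsr t0) => x x0.
by rewrite /flat x0.
Qed.

Lemma is_derive_flat_neg j (t : R) : t < 0 ->
  is_derive t (1 : R) (flat j : R -> R^o) 0.
Proof.
move=> t0; have := is_derive_cst (0 : R^o) t (1 : R).
apply: near_eq_is_derive; apply: filterS (lt_nbhsl t0) => x x0.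
by rewrite /flat ltNge ltW.
Qed.

(** The difference quotient of [flat j] at 0 is the function [flat j.+1], which tends to 0 by
    [flat_bound]. *)
Lemma is_derive_flat0 j : is_derive (0 : R) (1 : R) (flat j : R -> R^o) 0.
Proof.
suff C : ((fun h => h^-1 *: (((flat j : R -> R^o) \o shift 0) (h *: (1 : R)) - flat j 0))
    @ (0 : R)^')
     --> (0 : R^o).
  by split; [apply/cvg_ex; exists 0|exact: cvg_lim C].
have E : (fun h => h^-1 *: (((flat j : R -> R^o) \o shift 0) (h *: (1 : R)) - flat j 0)) = flat j.+1.
  apply/funext => h /=; rewrite addr0 {2}/flat ltxx subr0 [h *: _]mulr1 /flat.
  by case: ifP => _; rewrite ?scaler0// [_ *: _]mulrA exprS.
rewrite E; apply: cvg_within_filter.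
apply/(@cvgrPdist_le _ _ _ (nbhs (0 : R))) => e e0.
have d0 : 0 < e / (j.+2)`!%:R by rewrite divr_gt0// ltr0n fact_gt0.
apply/nbhs_ballP; exists (e / (j.+2)`!%:R) => // h; rewrite -ball_normE /= sub0r normrN => hd.
rewrite sub0r normrN; apply: le_trans (flat_bound _ _) _.
by rewrite mulrC -ler_pdivlMr ?ltr0n ?fact_gt0// ltW.
Qed.

(** The sum over [bool] puts the derivative in the form that [ck_at_comp1] expects: two members of
    the family with constant coefficients. *)
Lemma is_derive_flat j (t : R) :
  is_derive t (1 : R) (flat j : R -> R^o)
   (\sum_(b : bool) (if b then 1 else - j%:R) * flat (if b then j.+2 else j.+1) t).
Proof.
rewrite big_bool /= mul1r mulNr.
have [t0|t0|->] := ltgtP t 0.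
- by have := is_derive_flat_neg j t0; rewrite /flat !(ltNge, ltW t0)/= mulr0 subr0.
- exact: is_derive_flat_pos.
- by have := is_derive_flat0 j; rewrite /flat ltxx mulr0 subr0.
Qed.

Lemma ck_at_flat n k (z : 'rV[R]_n) f j : ck_at k z f ->
  ck_at k z (fun x => flat j (f x)).
Proof.
exact: (ck_at_comp1 (c := fun j b => if b then 1 else - j%:R)
  (s := fun j (b : bool) => if b then j.+2 else j.+1) is_derive_flat).
Qed.

Lemma flat_gt0 j (t : R) : 0 < t -> 0 < flat j t.
Proof. by move=> t0; rewrite /flat t0 mulr_gt0 ?expR_gt0// exprn_gt0// invr_gt0. Qed.

Lemma flat_ge0 j (t : R) : 0 <= flat j t.
Proof.
have [t0|] := ltP 0 t; first by rewrite ltW// flat_gt0.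
by rewrite /flat ltNge => ->.
Qed.

Lemma flat_le0 j (t : R) : t <= 0 -> flat j t = 0.
Proof. by rewrite /flat ltNge => ->. Qed.

(** A C^oo transition from 0 to 1 over the unit interval. The denominator is positive, because [t]
    and [1 - t] are never both nonpositive. *)
Definition step (t : R) : R := flat 0 t / (flat 0 t + flat 0 (1 - t)).

Lemma step_den (t : R) : flat 0 t + flat 0 (1 - t) != 0.
Proof.
have [t0|t0] := ltP 0 t.
  by rewrite gt_eqF// ltr_pwDl ?flat_gt0 ?flat_ge0.
by rewrite gt_eqF// ltr_wpDl ?flat_ge0// flat_gt0// subr_gt0 (le_lt_trans t0).
Qed.

Lemma step0 (t : R) : t <= 0 -> step t = 0.
Proof. by move=> t0; rewrite /step flat_le0 ?mul0r. Qed.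

Lemma step1 (t : R) : 1 <= t -> step t = 1.
Proof.
move=> t1; have := step_den t; rewrite /step [flat 0 (1 - t)]flat_le0 ?subr_le0//.
by rewrite addr0 => /divff.
Qed.

Lemma ck_at_step n k (z : 'rV[R]_n) f : ck_at k z f ->
  ck_at k z (fun x => step (f x)).
Proof.
move=> cf; apply: ck_at_mul; first exact: ck_at_flat.
apply: ck_at_inv; first exact: step_den.
apply: ck_at_add; first exact: ck_at_flat.
apply: ck_at_flat; apply: ck_at_add; first exact: ck_at_cst.
apply: ck_at_eq (ck_at_mul (ck_at_cst k z (-1)) cf).
by near=> x; rewrite mulN1r.
Unshelve. all: by end_near.
Qed.
End Flat.

(** * Smooth atlases, tangent vectors and brackets *)

Section Atlas.
Context {R : realType} {n : nat} {T : Type}.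

Definition cinf_at (z : 'rV[R]_n) f := forall k, ck_at k z f.

(** What [M] and [M'] have in common. No topological space is involved, since [M'] carries no
    topology other than that of its charts. *)
Record smooth_atlas (A : atlas R n T) : Prop := SmoothAtlas {
  atlas_cover : forall p, exists a : chart_index A, chart_dom a p;
  atlas_inj : forall (a : chart_index A) p q, chart_dom a p -> chart_dom a q ->
    chart_coord a p = chart_coord a q -> p = q;
  atlas_dom_open : forall a : chart_index A, aopen A (chart_dom a);
  atlas_coord_smooth : forall (b : chart_index A) i,
    smooth_on A (chart_dom b) (fun p => chart_coord b p 0 i) }.

Existing Class smooth_atlas.

Definition anbhs (A : atlas R n T) (p : T) : set_system T :=
  [set P | exists O, [/\ aopen A O, O p & O `<=` P]].

Definition cfun (A : atlas R n T) (a : chart_index A) (i : 'I_n) : T -> R :=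
  fun p => chart_coord a p 0 i.

(** The change of coordinates from [b] to [a], meaningful on the overlap only. Its entries are local
    expressions of coordinate functions, so [atlas_coord_smooth] applies to them directly. *)
Definition transition (A : atlas R n T) (a b : chart_index A) (x : 'rV[R]_n) :
  'rV[R]_n := \row_j local_expr b (cfun a j) x.

Variable A : atlas R n T.

(** Injectivity is a hypothesis on the spot, because the charts of [M'] need this formula before
    they are known to form a [smooth_atlas]. *)
Lemma local_expr_coord (a : chart_index A) (f : T -> R) p :
  (forall q, chart_dom a q -> chart_coord a q = chart_coord a p -> q = p) ->
  chart_dom a p -> local_expr a f (chart_coord a p) = f p.
Proof.
move=> inj dp; rewrite /local_expr; case: xgetP => [_ _ [q [dq eq] <-]|/(_ (f p)) []].
  by congr f; exact: inj.
by exists p.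
Qed.

Hypothesis sA : smooth_atlas A.
Implicit Types (a b : chart_index A) (p q : T) (f g : T -> R).

Lemma dom_aopen a : aopen A (chart_dom a).
Proof. exact: (atlas_dom_open sA). Qed.
Arguments dom_aopen : clear implicits.

Lemma local_exprE a p f : chart_dom a p ->
  local_expr a f (chart_coord a p) = f p.
Proof.
by move=> dp; apply: local_expr_coord => // q dq; exact: (atlas_inj sA dq dp).
Qed.

Lemma aopen_img a p O : aopen A O -> O p -> chart_dom a p ->
  \forall z \near chart_coord a p, exists q, [/\ chart_dom a q, chart_coord a q = z & O q].
Proof.
move=> oO Op dp.
have : nbhs (chart_coord a p) (chart_coord a @` (O `&` chart_dom a)).
  by apply: open_nbhs_nbhs; split; [exact: oO|exists p].
by apply: filterS => z [q [Oq dq] <-]; exists q.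
Qed.

Lemma transitionE a b p : chart_dom a p -> chart_dom b p ->
  transition a b (chart_coord b p) = chart_coord a p.
Proof. by move=> da db; apply/rowP => j; rewrite mxE local_exprE. Qed.

Lemma transition_cinf a b p j : chart_dom a p -> chart_dom b p ->
  cinf_at (chart_coord b p) (fun x => transition a b x 0 j).
Proof.
move=> da db k; rewrite (_ : (fun x => _) = local_expr b (cfun a j)); last first.
  by apply/funext => x; rewrite mxE.
have oV : open (chart_coord b @` (chart_dom a `&` chart_dom b)) by exact: (dom_aopen a).
have /(_ k)/(CkP k _ oV) := atlas_coord_smooth sA a j b.
by apply; exists p.
Qed.

Lemma transition_continuous a b p : chart_dom a p -> chart_dom b p ->
  {for chart_coord b p, continuous (transition a b)}.
Proof.
move=> da db; apply: (nbhs_singleton (row_near_continuous (k := 0%N) _)) => j.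
exact: transition_cinf.
Qed.

(** Openness has to be tested in every chart [b]; there it follows from the continuity of the
    transition map. *)
Lemma aopen_chart a (V : set 'rV[R]_n) : open V ->
  aopen A [set q | chart_dom a q /\ V (chart_coord a q)].
Proof.
move=> oV b; rewrite openE => _ [q [[dq Vq] dbq] <-]; rewrite /interior.
have Vt : nbhs (transition a b (chart_coord b q)) V.
  by rewrite transitionE//; apply: open_nbhs_nbhs.
have Ht := near_comp (transition_continuous dq dbq) Vt.
have Hd := aopen_img (dom_aopen a) dq dbq.
apply: filterS2 Ht Hd => z + [q' [dbq' zq' daq']]; rewrite -zq' => Vz.
by exists q' => //; split=> //; split=> //; move: Vz; rewrite /= transitionE.
Qed.

Lemma anbhsE a p (P : set T) : chart_dom a p ->
  anbhs A p P <-> \forall z \near chart_coord a p,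
    exists q, [/\ chart_dom a q, chart_coord a q = z & P q].
Proof.
move=> dp; split=> [ [ O [oO Op OP]] |].
  by apply: filterS (aopen_img oO Op dp) => z [q [? ? /OP ?]]; exists q.
rewrite -nbhs_nearE nbhsE => -[V [oV Vp] VP].
exists [set q | chart_dom a q /\ V (chart_coord a q)]; split=> //; first exact: aopen_chart.
move=> q [dq /VP [q' [dq' E Pq']]].
by rewrite -(atlas_inj sA dq' dq E).
Qed.

(** Images do not commute with intersections, so the intersection is handled in a chart, where
    injectivity identifies the two preimages. *)
#[global] Instance anbhs_filter p : Filter (anbhs A p).
Proof.
have [a dp] := atlas_cover sA p; split.
- apply/(anbhsE _ dp); apply: filterS (aopen_img (dom_aopen a) dp dp) => z [q [? ? _]].
  by exists q.
- move=> P Q /(anbhsE _ dp) hP /(anbhsE _ dp) hQ; apply/(anbhsE _ dp).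
  apply: filterS2 hP hQ => z [q [dq <- Pq]] [q' [dq' E Qq']].
  by exists q; split=> //; split=> //; rewrite -(atlas_inj sA dq' dq E).
- by move=> P Q PQ [ O [? ? OP]]; exists O; split=> //; exact: subset_trans PQ.
Qed.

Lemma anbhs_singleton p (P : set T) : anbhs A p P -> P p.
Proof. by move=> [ O [_ Op /(_ _ Op)]]. Qed.

Lemma anbhs_dom a p : chart_dom a p -> anbhs A p (chart_dom a).
Proof. by move=> dp; exists (chart_dom a); split=> //; exact: dom_aopen. Qed.

Lemma anbhs_chart a p (P : set T) : chart_dom a p -> anbhs A p P ->
  \forall z \near chart_coord a p, exists q, [/\ chart_dom a q, chart_coord a q = z & P q].
Proof. by move=> dp /(anbhsE _ dp). Qed.

Lemma cinf_at_eq (z : 'rV[R]_n) (f g : 'rV[R]_n -> R) : (\forall z' \near z, f z' = g z') ->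
  cinf_at z f -> cinf_at z g.
Proof. by move=> fg cf k; apply: ck_at_eq fg (cf k). Qed.

Lemma near_cinf_at_eq (z : 'rV[R]_n) (f g : 'rV[R]_n -> R) :
  (\forall z' \near z, f z' = g z') ->
  (\forall z' \near z, cinf_at z' f) -> (\forall z' \near z, cinf_at z' g).
Proof. by move=> /near_join fg; apply: filterS2 fg => z' /cinf_at_eq; exact. Qed.

(* [cinf_at] at the point itself would not suffice: the neighbourhood on which [f] is C^k
   must not depend on [k]. *)
Lemma smooth_nearP a p f : chart_dom a p ->
  smooth_near A p f <-> \forall z \near chart_coord a p, cinf_at z (local_expr a f).
Proof.
move=> dp; split=> [ [ O [oO Op sf]] |].
  have := aopen_img oO Op dp; apply: filterS => z [q [dq <- Oq]] k.
  have /(CkP k _ (oO a)) := sf a k; apply; by exists q.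
rewrite -nbhs_nearE nbhsE => -[V [oV Vp] VP].
exists [set q | chart_dom a q /\ V (chart_coord a q)]; split=> //; first exact: aopen_chart.
move=> b k; apply/CkP; first exact: aopen_chart.
move=> _ [q [[dq Vq] dbq] <-].
have Hd := aopen_img (dom_aopen a) dq dbq.
(* In any other chart [b], the function is its expression in [a] after the transition map. *)
apply: (@ck_at_eq _ _ _ _ (fun x => local_expr a f (transition a b x))).
  apply: filterS Hd => z [q' [dq' <- daq']].
  by rewrite transitionE// !local_exprE.
apply: ck_at_comp => [j|]; first exact: transition_cinf.
by rewrite transitionE//; exact: VP.
Qed.

Lemma smooth_near_chart a p f (G : 'rV[R]_n -> R) : chart_dom a p ->
  (\forall z \near chart_coord a p, cinf_at z G) ->
  (forall q, chart_dom a q -> f q = G (chart_coord a q)) -> smooth_near A p f.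
Proof.
move=> dp cG fG; apply/(smooth_nearP _ dp); apply: near_cinf_at_eq cG.
have := anbhs_chart dp (anbhs_dom dp); apply: filterS => z [q [dq <- _]].
by rewrite local_exprE// fG.
Qed.

Lemma smooth_near_eq p f g : anbhs A p (fun q => f q = g q) ->
  smooth_near A p f -> smooth_near A p g.
Proof.
have [a dp] := atlas_cover sA p; move=> /(anbhs_chart dp) fg.
move=> /(smooth_nearP _ dp) sf; apply/(smooth_nearP _ dp); apply: near_cinf_at_eq sf.
by apply: filterS fg => z [q [dq <- fgq]]; rewrite !local_exprE.
Qed.

Lemma smooth_near_near p f : smooth_near A p f -> anbhs A p (fun q => smooth_near A q f).
Proof. by move=> [ O [oO Op sf]]; exists O; split=> // q Oq; exists O. Qed.

Lemma smooth_near_cst p (c : R) : smooth_near A p (fun=> c).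
Proof.
have [a dp] := atlas_cover sA p; apply: (@smooth_near_chart a _ _ (fun=> c)) => //.
by near=> z => k; exact: ck_at_cst.
Unshelve. all: by end_near.
Qed.

Lemma smooth_near_add p f g : smooth_near A p f -> smooth_near A p g ->
  smooth_near A p (fun q => f q + g q).
Proof.
have [a dp] := atlas_cover sA p; move=> /(smooth_nearP _ dp) sf /(smooth_nearP _ dp) sg.
apply: (smooth_near_chart (a := a) (G := fun x => local_expr a f x + local_expr a g x)) => //.
  by apply: filterS2 sf sg => z cf cg k; exact: ck_at_add.
by move=> q dq; rewrite !local_exprE.
Qed.

Lemma smooth_near_mul p f g : smooth_near A p f -> smooth_near A p g ->
  smooth_near A p (fun q => f q * g q).
Proof.
have [a dp] := atlas_cover sA p; move=> /(smooth_nearP _ dp) sf /(smooth_nearP _ dp) sg.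
apply: (smooth_near_chart (a := a) (G := fun x => local_expr a f x * local_expr a g x)) => //.
  by apply: filterS2 sf sg => z cf cg k; exact: ck_at_mul.
by move=> q dq; rewrite !local_exprE.
Qed.

Lemma smooth_near_opp p f : smooth_near A p f -> smooth_near A p (fun q => - f q).
Proof.
move=> /(smooth_near_mul (smooth_near_cst p (-1))); apply: smooth_near_eq.
by apply: filterE => q; rewrite mulN1r.
Qed.

Lemma smooth_near_inv p f : f p != 0 -> smooth_near A p f ->
  smooth_near A p (fun q => (f q)^-1).
Proof.
have [a dp] := atlas_cover sA p; move=> f0 /(smooth_nearP _ dp) sf.
apply: (smooth_near_chart (a := a) (G := fun x => (local_expr a f x)^-1)) => //; last first.
  by move=> q dq; rewrite !local_exprE.
have cf : {for chart_coord a p, continuous (local_expr a f)}.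
  exact: nbhs_singleton (ck_at_continuous (nbhs_singleton sf 0%N)).
have nz : local_expr a f (chart_coord a p) != 0 by rewrite local_exprE.
have cf0 : \forall z \near chart_coord a p, local_expr a f z != 0.
  exact: (cvgr_neq0 _ cf nz).
by apply: filterS2 sf cf0 => z cf' z0 k; exact: ck_at_inv.
Qed.

Lemma smooth_near_sum p (I : Type) (r : seq I) (P : pred I) (h : I -> T -> R) :
  (forall i, P i -> smooth_near A p (h i)) ->
  smooth_near A p (fun q => \sum_(i <- r | P i) h i q).
Proof.
move=> H; elim: r => [|i r IH].
  by apply: smooth_near_eq (smooth_near_cst p 0); apply: filterE => x; rewrite big_nil.
have [Pi|Pi] := boolP (P i).
  apply: smooth_near_eq (smooth_near_add (H i Pi) IH).
  by apply: filterE => x; rewrite big_cons Pi.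
by apply: smooth_near_eq IH; apply: filterE => x; rewrite big_cons (negbTE Pi).
Qed.

Lemma smooth_near_prod p (I : Type) (r : seq I) (P : pred I) (h : I -> T -> R) :
  (forall i, P i -> smooth_near A p (h i)) ->
  smooth_near A p (fun q => \prod_(i <- r | P i) h i q).
Proof.
move=> H; elim: r => [|i r IH].
  by apply: smooth_near_eq (smooth_near_cst p 1); apply: filterE => x; rewrite big_nil.
have [Pi|Pi] := boolP (P i).
  apply: smooth_near_eq (smooth_near_mul (H i Pi) IH).
  by apply: filterE => x; rewrite big_cons Pi.
by apply: smooth_near_eq IH; apply: filterE => x; rewrite big_cons (negbTE Pi).
Qed.

Lemma smooth_near_det p m (B : T -> 'M[R]_m) :
  (forall i j, smooth_near A p (fun q => B q i j)) ->
  smooth_near A p (fun q => \det (B q)).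
Proof.
move=> H; apply: smooth_near_sum => s _; apply: smooth_near_mul; first exact: smooth_near_cst.
by apply: smooth_near_prod => i _; exact: H.
Qed.

Lemma cfun_smooth a p i : chart_dom a p -> smooth_near A p (cfun a i).
Proof.
move=> dp; apply: (@smooth_near_chart a _ _ (fun x => x 0 i)) => //.
by near=> z => k; exact: ck_at_coord.
Unshelve. all: by end_near.
Qed.

(** * Tangent vectors in coordinates *)

Lemma dir_deriv_ns a p y f : ~ smooth_near A p f -> dir_deriv a p y f = 0.
Proof. by move=> nf; rewrite /dir_deriv; case: asboolP. Qed.

Lemma partial_ns a p i f : ~ smooth_near A p f -> partial a i p f = 0.
Proof. exact: dir_deriv_ns. Qed.

Lemma partialE a p i f : smooth_near A p f ->
  partial a i p f = pd i (local_expr a f) (chart_coord a p).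
Proof. by move=> sf; rewrite /partial /dir_deriv asboolT// pdE. Qed.

Lemma smooth_near_ck k a p f : chart_dom a p -> smooth_near A p f ->
  ck_at k (chart_coord a p) (local_expr a f).
Proof. by move=> dp sf; have /nbhs_singleton := proj1 (smooth_nearP _ dp) sf; apply. Qed.

Lemma dir_derivE a p y f : chart_dom a p ->
  dir_deriv a p y f = \sum_i y 0 i * partial a i p f.
Proof.
move=> dp; have [sf|nf] := pselect (smooth_near A p f); last first.
  by rewrite dir_deriv_ns// big1// => i _; rewrite partial_ns// mulr0.
rewrite /dir_deriv asboolT// ck1_deriveE.
  by apply: eq_bigr => i _; rewrite partialE.
by have /nbhs_singleton := proj1 (smooth_nearP _ dp) sf; apply.
Qed.

Lemma partial_cfun a p i j : chart_dom a p -> partial a i p (cfun a j) = (i == j)%:R.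
Proof.
move=> dp; rewrite partialE; last exact: cfun_smooth.
rewrite (@near_eq_pd _ _ _ _ _ (fun x => x 0 j)); last first.
  have := anbhs_chart dp (anbhs_dom dp); apply: filterS => z [q [dq <- _]].
  by rewrite local_exprE.
by rewrite -pdE; have [_ ->] := is_derive_coord (chart_coord a p) 'e_i j; rewrite mxE eqxx eq_sym.
Qed.

(** The chain rule for the transition map. No smoothness of [f] is assumed, since both sides are 0
    otherwise. *)
Lemma partial_chain a b p j f : chart_dom a p -> chart_dom b p ->
  partial b j p f = \sum_i partial b j p (cfun a i) * partial a i p f.
Proof.
move=> da db; have [sf|nf] := pselect (smooth_near A p f); last first.
  by rewrite partial_ns// big1// => i _; rewrite [X in _ * X]partial_ns// mulr0.
rewrite partialE//.
rewrite (@near_eq_pd _ _ _ _ _ (local_expr a f \o transition a b)); last first.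
  apply: filterS (anbhs_chart db (filterI (anbhs_dom da) (anbhs_dom db))) => z [q [dbq <- [daq _]]].
  by rewrite local_exprE//= transitionE// local_exprE.
have cf : ck_at 1 (transition a b (chart_coord b p)) (local_expr a f).
  rewrite transitionE//.
  by have /nbhs_singleton := proj1 (smooth_nearP _ da) sf; apply.
have ct i : ck_at 1 (chart_coord b p) (fun x => transition a b x 0 i).
  exact: transition_cinf.
have [_ E] := is_derive_comp_row 'e_j ct cf.
rewrite -pdE E; apply: eq_bigr => i _.
rewrite !partialE//; last exact: cfun_smooth.
rewrite transitionE// pdE; congr (pd _ _ _ * _).
by apply/funext => x; rewrite mxE.
Qed.

(** Replaces the existential chart in [tangent] by any chart at [p]. The resulting condition is
    linear in [w], which makes the tangent vectors at [p] a vector space. *)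
Lemma tangentP a p w : chart_dom a p ->
  tangent A p w <-> forall f, w f = \sum_i w (cfun a i) * partial a i p f.
Proof.
move=> dp; split=> [[b [y [db ->]]] f|H].
  rewrite dir_derivE//.
  under [RHS]eq_bigr => i _ do rewrite dir_derivE// mulr_suml.
  rewrite exchange_big /=; apply: eq_bigr => j _.
  by rewrite (partial_chain _ _ dp db) mulr_sumr; apply: eq_bigr => i _; rewrite mulrA.
exists a, (\row_i w (cfun a i)); split=> //; apply/funext => f.
by rewrite dir_derivE// H; apply: eq_bigr => i _; rewrite mxE.
Qed.

Lemma tangent_partial a p i : chart_dom a p -> tangent A p (partial a i p).
Proof. by move=> dp; exists a, (delta_mx 0 i). Qed.

Lemma tangentD p c u w : tangent A p u -> tangent A p w -> tangent A p (c \*o u + w).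
Proof.
have [a dp] := atlas_cover sA p; move=> /(tangentP _ dp) tu /(tangentP _ dp) tw.
apply/(tangentP _ dp) => f; rewrite fctE /= tu tw mulr_sumr -big_split /=.
by apply: eq_bigr => i _; rewrite mulrDl mulrA.
Qed.

Lemma tangent0 p : tangent A p 0.
Proof.
have [a dp] := atlas_cover sA p; apply/(tangentP _ dp) => f.
by rewrite big1// => i _; rewrite mul0r.
Qed.

Lemma tangent_scale p c u : tangent A p u -> tangent A p (c \*o u).
Proof. by move=> tu; have := tangentD c tu (tangent0 p); rewrite addr0. Qed.

Lemma tangent_opp p u : tangent A p u -> tangent A p (- u).
Proof.
move=> /(tangent_scale (-1)); congr tangent; apply/funext => f.
by rewrite /= mulN1r.
Qed.

Lemma tangent_add p u w : tangent A p u -> tangent A p w -> tangent A p (u + w).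
Proof.
move=> tu tw; have := tangentD 1 tu tw; congr tangent; apply/funext => f.
by rewrite !fctE /= mul1r.
Qed.

Lemma tangent_sum p (I : Type) (r : seq I) (P : pred I) (c : I -> R) (u : I -> vect R T) :
  (forall i, tangent A p (u i)) -> tangent A p (\sum_(i <- r | P i) (c i \*o u i)).
Proof.
move=> H; elim/big_ind: _ => [|u' w tu tw|i _]; [exact: tangent0|exact: tangent_add|].
exact: tangent_scale.
Qed.

Lemma tangent_ns p w f : tangent A p w -> ~ smooth_near A p f -> w f = 0.
Proof. by move=> [a [y [_ ->]]]; exact: dir_deriv_ns. Qed.

Lemma tangent_eq p w f g : tangent A p w -> anbhs A p (fun q => f q = g q) -> w f = w g.
Proof.
have [a dp] := atlas_cover sA p; move=> tw fg.
have gf : anbhs A p (fun q => g q = f q) by apply: filterS fg => q ->.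
have [sf|nf] := pselect (smooth_near A p f); last first.
  by rewrite !(tangent_ns tw)// => /(smooth_near_eq gf).
have sg := smooth_near_eq fg sf.
move: tw => /(tangentP _ dp) tw; rewrite !tw; apply: eq_bigr => i _; congr (_ * _).
rewrite !partialE//; apply: near_eq_pd.
by have := anbhs_chart dp fg; apply: filterS => z [q [dq <- fgq]]; rewrite !local_exprE.
Qed.

Lemma local_expr_near a p f (F : 'rV[R]_n -> R) : chart_dom a p ->
  (forall q, chart_dom a q -> f q = F (chart_coord a q)) ->
  \forall z \near chart_coord a p, local_expr a f z = F z.
Proof.
move=> dp fF; have := anbhs_chart dp (anbhs_dom dp); apply: filterS => z [q [dq <- _]].
by rewrite local_exprE// fF.
Qed.

Lemma smooth_near_derivable a p i f : chart_dom a p -> smooth_near A p f ->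
  is_derive (chart_coord a p) ('e_i : 'rV[R]_n) (local_expr a f : _ -> R^o)
    (partial a i p f : R^o).
Proof.
move=> dp sf; rewrite partialE//.
have /nbhs_singleton := proj1 (smooth_nearP _ dp) sf.
by move=> /(_ 1%N)/(ck_at_is_derive i)/nbhs_singleton.
Qed.

Lemma partialM a p i f g : chart_dom a p -> smooth_near A p f -> smooth_near A p g ->
  partial a i p (fun q => f q * g q) = f p * partial a i p g + g p * partial a i p f.
Proof.
move=> dp sf sg; rewrite partialE; last exact: smooth_near_mul.
rewrite (@near_eq_pd _ _ _ _ _ (fun x => local_expr a f x * local_expr a g x)); last first.
  have := anbhs_chart dp (anbhs_dom dp); apply: filterS => z [q [dq <- _]].
  by rewrite !local_exprE.
have [_ E] := is_deriveM (smooth_near_derivable i dp sf) (smooth_near_derivable i dp sg).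
by rewrite -pdE E !local_exprE.
Qed.

Lemma partialD a p i f g : chart_dom a p -> smooth_near A p f -> smooth_near A p g ->
  partial a i p (fun q => f q + g q) = partial a i p f + partial a i p g.
Proof.
move=> dp sf sg; rewrite partialE; last exact: smooth_near_add.
rewrite (@near_eq_pd _ _ _ _ _ (fun x => local_expr a f x + local_expr a g x)); last first.
  have := anbhs_chart dp (anbhs_dom dp); apply: filterS => z [q [dq <- _]].
  by rewrite !local_exprE.
have [_ E] := is_deriveD (smooth_near_derivable i dp sf) (smooth_near_derivable i dp sg).
by rewrite -pdE E.
Qed.

Lemma tangentM p w f g : tangent A p w -> smooth_near A p f -> smooth_near A p g ->
  w (fun q => f q * g q) = f p * w g + g p * w f.
Proof.
have [a dp] := atlas_cover sA p; move=> /(tangentP _ dp) tw sf sg.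
rewrite [LHS]tw tw (tw f) !mulr_sumr -big_split /=; apply: eq_bigr => i _.
by rewrite partialM// mulrDr; congr (_ + _); rewrite mulrCA.
Qed.

Lemma tangent_addf p w f g : tangent A p w -> smooth_near A p f -> smooth_near A p g ->
  w (fun q => f q + g q) = w f + w g.
Proof.
have [a dp] := atlas_cover sA p; move=> /(tangentP _ dp) tw sf sg.
rewrite [LHS]tw tw (tw g) -big_split /=; apply: eq_bigr => i _.
by rewrite partialD// mulrDr.
Qed.

Lemma tangent_cst p w (c : R) : tangent A p w -> w (fun=> c) = 0.
Proof.
have [a dp] := atlas_cover sA p; move=> /(tangentP _ dp) tw.
rewrite tw big1// => i _; rewrite partialE; last exact: smooth_near_cst.
rewrite (@near_eq_pd _ _ _ _ _ (fun=> c)); last first.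
  exact: (@local_expr_near a p _ (fun=> c) dp).
by rewrite -pdE; have [_ ->] := is_derive_cst (c : R^o) (chart_coord a p) 'e_i; rewrite mulr0.
Qed.

Lemma tangent_sumf p w (I : Type) (r : seq I) (P : pred I) (h : I -> T -> R) :
  tangent A p w -> (forall i, P i -> smooth_near A p (h i)) ->
  w (fun q => \sum_(i <- r | P i) h i q) = \sum_(i <- r | P i) w (h i).
Proof.
move=> tw H; elim: r => [|i r IH].
  rewrite big_nil (_ : (fun _ => _) = fun=> 0) ?(tangent_cst 0 tw)//.
  by apply/funext => q; rewrite big_nil.
rewrite big_cons; case: ifPn => Pi.
  rewrite -IH -(tangent_addf tw); [|exact: H|exact: smooth_near_sum].
  by congr w; apply/funext => q; rewrite big_cons Pi.
by rewrite -IH; congr w; apply/funext => q; rewrite big_cons (negbTE Pi).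
Qed.

Lemma partial_near a p i f : chart_dom a p -> smooth_near A p f ->
  anbhs A p (fun q => partial a i q f = pd i (local_expr a f) (chart_coord a q)).
Proof. by move=> dp sf; apply: filterS (smooth_near_near sf) => q sq; rewrite partialE. Qed.

Lemma partial_smooth a p i f : chart_dom a p -> smooth_near A p f ->
  smooth_near A p (act (partial a i) f).
Proof.
move=> dp sf.
have : smooth_near A p (fun q => pd i (local_expr a f) (chart_coord a q)).
  apply: (smooth_near_chart (a := a) (G := pd i (local_expr a f))) => //.
  have := proj1 (smooth_nearP _ dp) sf; apply: filterS => z cz k.
  exact: ck_at_pd (cz k.+1).
by apply: smooth_near_eq; apply: filterS (partial_near i dp sf) => q.
Qed.

Lemma partial_comm a p i j f : chart_dom a p -> smooth_near A p f ->
  partial a i p (act (partial a j) f) = partial a j p (act (partial a i) f).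
Proof.
move=> dp sf.
have H k l : partial a k p (act (partial a l) f) =
    pd k (pd l (local_expr a f)) (chart_coord a p).
  rewrite partialE; last exact: partial_smooth.
  apply: near_eq_pd.
  apply: filterS (anbhs_chart dp (filterI (anbhs_dom dp) (partial_near l dp sf))).
  move=> z [q [dq <- [_ E]]].
  by rewrite local_exprE.
rewrite !H; apply: schwarz.
by have /nbhs_singleton := proj1 (smooth_nearP _ dp) sf; apply.
Qed.

(** * Vector fields and their brackets *)

Lemma vfield_tangent X p : vfield A X -> tangent A p (X p).
Proof. by move=> [+ _]; apply. Qed.

Lemma vfield_smooth X p f : vfield A X -> smooth_near A p f -> smooth_near A p (act X f).
Proof. by move=> [_]; apply. Qed.

Lemma act_near X a p f : (forall p, tangent A p (X p)) -> chart_dom a p ->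
  anbhs A p (fun q => act X f q = \sum_i act X (cfun a i) q * act (partial a i) f q).
Proof.
move=> tX dp; apply: filterS (anbhs_dom dp) => q dq.
exact: (proj1 (tangentP _ dq) (tX q)).
Qed.

(** Near [p], [X f] is the sum of the products of [X x^i] with the partial derivatives of [f], so
    only the components need to be smooth. *)
Lemma vfield_intro X : (forall p, tangent A p (X p)) ->
  (forall p, exists2 a : chart_index A,
    chart_dom a p & forall i, smooth_near A p (act X (cfun a i))) ->
  vfield A X.
Proof.
move=> tX sX; split=> // p f _ sf; have [a dp sXi] := sX p.
have : smooth_near A p (fun q => \sum_i act X (cfun a i) q * act (partial a i) f q).
  by apply: smooth_near_sum => i _; apply: smooth_near_mul => //; exact: partial_smooth.
apply: smooth_near_eq; apply: filterS (act_near f tX dp) => q; exact: esym.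
Qed.

Lemma vfieldD X Y : vfield A X -> vfield A Y -> vfield A (X + Y).
Proof.
move=> vX vY; split=> [p _|p f _ sf]; first by apply: tangent_add; exact: vfield_tangent.
by apply: (smooth_near_add (f := act X f) (g := act Y f)); exact: vfield_smooth.
Qed.

Lemma vfieldN X : vfield A X -> vfield A (- X).
Proof.
move=> vX; split=> [p _|p f _ sf]; first by apply: tangent_opp; exact: vfield_tangent.
by apply: (smooth_near_opp (f := act X f)); exact: vfield_smooth.
Qed.

Lemma vfieldB X Y : vfield A X -> vfield A Y -> vfield A (X - Y).
Proof. by move=> vX vY; apply: vfieldD => //; exact: vfieldN. Qed.

Lemma vfield0 : vfield A 0.
Proof.
by split=> [p _|p f _ sf]; [exact: tangent0|exact: smooth_near_cst].
Qed.

Lemma vfieldZ f X : smooth A f -> vfield A X -> vfield A (fscale f X).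
Proof.
move=> sf vX; split=> [p _|p g _ sg]; first by apply: tangent_scale; exact: vfield_tangent.
by apply: (smooth_near_mul (g := act X g)); [exact: sf|exact: vfield_smooth].
Qed.

Lemma bracketE X Y p f : smooth_near A p f ->
  bracket A X Y p f = X p (act Y f) - Y p (act X f).
Proof. by move=> sf; rewrite /bracket asboolT. Qed.

Lemma bracket_ns X Y p f : ~ smooth_near A p f -> bracket A X Y p f = 0.
Proof. by move=> nf; rewrite /bracket; case: asboolP. Qed.

(** Separates the first-order part of [X Y] from the second-order part [X^i Y^j d_i d_j]. *)
Lemma act_act X Y a p f : vfield A X -> vfield A Y -> chart_dom a p -> smooth_near A p f ->
  X p (act Y f) =
    \sum_j X p (act Y (cfun a j)) * partial a j p f +
    \sum_j \sum_i X p (cfun a i) * (Y p (cfun a j) * partial a i p (act (partial a j) f)).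
Proof.
move=> vX vY dp sf; have tX := vfield_tangent p vX.
have sYj j : smooth_near A p (act Y (cfun a j)).
  by apply: vfield_smooth vY _; exact: cfun_smooth.
have spj j : smooth_near A p (act (partial a j) f) by exact: partial_smooth.
rewrite (tangent_eq tX (act_near f (fun p => vfield_tangent p vY) dp)).
rewrite (tangent_sumf _ tX); last by move=> j _; exact: smooth_near_mul.
rewrite -big_split /=; apply: eq_bigr => j _.
rewrite (tangentM tX (sYj j) (spj j)) [LHS]addrC; congr (_ + _); first by rewrite mulrC.
rewrite (proj1 (tangentP _ dp) tX (act (partial a j) f)) mulr_sumr.
by apply: eq_bigr => i _; rewrite mulrCA.
Qed.

Lemma bracket_tangent X Y p : vfield A X -> vfield A Y -> tangent A p (bracket A X Y p).
Proof.
move=> vX vY; have [a dp] := atlas_cover sA p.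
apply/(tangentP _ dp) => f; have [sf|nf] := pselect (smooth_near A p f); last first.
  by rewrite bracket_ns// big1// => i _; rewrite partial_ns ?mulr0.
rewrite bracketE// (act_act vX vY dp sf) (act_act vY vX dp sf).
under [RHS]eq_bigr => i _ do rewrite (bracketE _ _ (cfun_smooth i dp)) mulrBl.
rewrite sumrB opprD addrACA; set S1 := (X in _ + (X - _)); set S2 := (X in _ + (_ - X)).
(* The second-order parts of [X Y] and [Y X] agree because partial derivatives commute; what remains
   is a first-order operator. *)
suff -> : S1 = S2 by rewrite subrr addr0.
rewrite /S1 exchange_big; apply: eq_bigr => i _; apply: eq_bigr => j _.
by rewrite (partial_comm _ _ dp sf) mulrCA.
Qed.

Lemma vfield_bracket X Y : vfield A X -> vfield A Y -> vfield A (bracket A X Y).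
Proof.
move=> vX vY; split=> [p _|p f _ sf]; first exact: bracket_tangent.
have : smooth_near A p (fun q => act X (act Y f) q + - act Y (act X f) q).
  apply: smooth_near_add; first exact: (vfield_smooth vX (vfield_smooth vY sf)).
  exact/smooth_near_opp/(vfield_smooth vY (vfield_smooth vX sf)).
apply: smooth_near_eq; apply: filterS (smooth_near_near sf) => q sq.
by rewrite /act bracketE.
Qed.

Lemma fieldDE (X Y : field R T) p f : (X + Y) p f = X p f + Y p f.
Proof. by []. Qed.

Lemma fieldNE (X : field R T) p f : (- X) p f = - X p f.
Proof. by []. Qed.

Lemma fscaleE h (X : field R T) p f : fscale h X p f = h p * X p f.
Proof. by []. Qed.

Lemma bracketC X Y : bracket A X Y = - bracket A Y X.
Proof.
apply/funext => p; apply/funext => f.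
rewrite fieldNE.
have [sf|nf] := pselect (smooth_near A p f); last by rewrite !bracket_ns// oppr0.
by rewrite !bracketE// opprB.
Qed.

Lemma bracketDr X Y Z : vfield A X -> vfield A Y -> vfield A Z ->
  bracket A X (Y + Z) = bracket A X Y + bracket A X Z.
Proof.
move=> vX vY vZ; apply/funext => p; apply/funext => f.
rewrite fieldDE.
have [sf|nf] := pselect (smooth_near A p f); last by rewrite !bracket_ns// addr0.
rewrite !bracketE// [X p (act (Y + Z) f)](_ : _ = X p (fun q => act Y f q + act Z f q))//.
rewrite (tangent_addf (vfield_tangent p vX) (vfield_smooth vY sf) (vfield_smooth vZ sf)).
by rewrite fieldDE opprD addrACA.
Qed.

Lemma bracketZr f X Y : smooth A f -> vfield A X -> vfield A Y ->
  bracket A X (fscale f Y) = fscale f (bracket A X Y) + fscale (act X f) Y.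
Proof.
move=> sf vX vY; apply/funext => p; apply/funext => h.
rewrite fieldDE !fscaleE.
have [sh|nh] := pselect (smooth_near A p h); last first.
  by rewrite !bracket_ns// (tangent_ns (vfield_tangent p vY) nh) !mulr0 addr0.
rewrite !bracketE// [X p (act (fscale f Y) h)](_ : _ = X p (fun q => f q * act Y h q))//.
rewrite (tangentM (vfield_tangent p vX) (sf p) (vfield_smooth vY sh)).
by rewrite fscaleE mulrBr addrAC [Y p h * _]mulrC.
Qed.
End Atlas.

(** * Bump functions *)

Section Bump.
Context {R : realType} {n : nat} {T : Type} (A : atlas R n T) (sA : smooth_atlas A).
(** Separation is needed only across the border of a chart domain: inside the domain the bump is
    given by a smooth formula. *)
Hypothesis sepA : forall (a : chart_index A) p q, chart_dom a p -> ~ chart_dom a q ->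
  exists O Q, [/\ aopen A O, aopen A Q, O p, Q q & O `&` Q `<=` set0].

(** A polynomial equal to 2 at [z0] and nonpositive at Euclidean distance at least [d] from it, so
    that [step] of it is 1 near [z0] and 0 away from it. *)
Let s (z0 : 'rV[R]_n) (d : R) (x : 'rV[R]_n) : R :=
  2 + - 2 / d ^+ 2 * \sum_i (x 0 i + - z0 0 i) * (x 0 i + - z0 0 i).

Let s_cinf z0 d k z : ck_at k z (s z0 d).
Proof.
apply: ck_at_add; first exact: ck_at_cst.
apply: ck_at_mul; first exact: ck_at_cst.
apply: ck_at_sum => i _.
by apply: ck_at_mul; apply: ck_at_add; (exact: ck_at_coord || exact: ck_at_cst).
Qed.

Let s_support z0 d x : 0 < d -> 0 < s z0 d x -> forall i, `|x 0 i - z0 0 i| <= d.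
Proof.
move=> d0; rewrite /s mulNr mulNr subr_gt0 mulrAC ltr_pdivrMr ?exprn_gt0// ltr_pM2l//.
move=> H i; rewrite -ler_sqr ?nnegrE ?normr_ge0 ?(ltW d0)// real_normK ?num_real//.
apply: le_trans (ltW H); rewrite (bigD1 i) //= expr2 lerDl.
by apply: sumr_ge0 => j _; rewrite -expr2 sqr_ge0.
Qed.

(** The last property asks for vanishing near [q], not just at [q]: it is what makes the product
    with a function that is smooth on the chart alone globally smooth. *)
Lemma exists_bump (a : chart_index A) p : chart_dom a p -> exists b : T -> R,
  [/\ smooth A b, anbhs A p (fun q => b q = 1) &
      forall q, ~ chart_dom a q -> anbhs A q (fun q' => b q' = 0)].
Proof.
move=> dp; set z0 := chart_coord a p.
have /nbhs_ballP[r /= r0 Hr] := anbhs_chart sA dp (anbhs_dom sA dp).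
(* Half of [r], so that the closed cube of half-width [d] still lies in the image of the chart. *)
pose d := r / 2; have d0 : 0 < d by rewrite divr_gt0.
have dr : d < r by rewrite ltr_pdivrMr// ltr_pMr// ltr1n.
pose b q := if `[< chart_dom a q >] then step (s z0 d (chart_coord a q)) else 0.
have bE q : chart_dom a q -> b q = step (s z0 d (chart_coord a q)).
  by move=> dq; rewrite /b asboolT.
have bout q : ~ chart_dom a q -> anbhs A q (fun q' => b q' = 0).
  move=> ndq.
  pose K := [set v : 'rV[R]_n | forall i, `[z0 0 i - d, z0 0 i + d]%classic (v 0 i)].
  have cK : compact K.
    apply: (@rV_compact R n (fun i => `[z0 0 i - d, z0 0 i + d]%classic)) => i.
    exact: segment_compact.
  (* Points of the compact [K] are separated from [q], hence so is [K]. *)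
  have /compact_near_coveringP/(_ T (anbhs A q)
    (fun q' z => ~ (chart_dom a q' /\ chart_coord a q' = z)) _) H := cK.
  have : \forall q' \near anbhs A q, K `<=` (fun z => ~ (chart_dom a q' /\ chart_coord a q' = z)).
    apply: H => z Kz.
    have [|q1 [dq1 <- _]] := Hr z.
      rewrite -ball_normE /=; apply: le_lt_trans dr; apply: norm_row_le; first exact: ltW.
      move=> i; have := Kz i; rewrite /= in_itv /= !mxE => /andP[h1 h2].
      by rewrite -/z0 ler_norml; apply/andP; split; lra.
    have [ O1 [Q1 [oO oQ Oq1 Qq OQ]]] := sepA dq1 ndq.
    exists ([set z' | exists q2, [/\ chart_dom a q2, chart_coord a q2 = z' & O1 q2]], Q1).
      split; first exact: (aopen_img oO Oq1 dq1).
      by exists Q1; split.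
    move=> [z' q'] /= [[q2 [dq2 E2 Oq2]] Qq'] [dq' E'].
    apply: (OQ q2); split=> //.
    by rewrite (atlas_inj sA dq2 dq')// E2.
  apply: filterS => q' Kq'; rewrite /b; case: asboolP => // dq'.
  apply: step0; rewrite leNgt; apply/negP => s0.
  apply: (Kq' (chart_coord a q')) => // i; rewrite /= in_itv /=.
  have := s_support d0 s0 i; rewrite ler_norml => /andP[h1 h2].
  by apply/andP; split; lra.
exists b; split => //.
- move=> q; have [dq|ndq] := pselect (chart_dom a q).
    apply: (smooth_near_chart sA (a := a) (G := fun x => step (s z0 d x))) => //.
    by apply: filterE => z k; exact/ck_at_step/s_cinf.
  by apply: smooth_near_eq (smooth_near_cst sA q 0); apply: filterS (bout q ndq).
- apply/(anbhsE sA _ dp).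
  have cs : {for z0, continuous (s z0 d)}.
    exact: nbhs_singleton (ck_at_continuous (s_cinf z0 d 0%N z0)).
  have s2 : 1 < s z0 d z0.
    rewrite /s big1 ?mulr0 ?addr0 ?ltr1n// => i _.
    by rewrite subrr mulr0.
  have Hs : \forall z \near z0, 1 < s z0 d z by exact: (cvgr_gt _ cs).
  apply: filterS2 Hs (anbhs_chart sA dp (anbhs_dom sA dp)) => z + [q [dq zq _]].
  rewrite -zq => s1; exists q; split => //.
  by rewrite bE// step1// ltW.
Qed.
End Bump.

(** * The atlas of an open subset of the tangent bundle *)

Section TangentAtlas.
Context {R : realType} {m : nat} (M : manifold R m).
Implicit Types (a b : chart_index (charts M)).

Lemma aopen_open (O : set M) : open O -> aopen (charts M) O.
Proof.
move=> oO a; apply: coord_open => [|q []//].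
by apply: openI => //; exact: dom_open.
Qed.

#[global] Instance manifold_atlas : smooth_atlas (charts M).
Proof.
split; [exact: dom_cover|exact: coord_inj|by move=> a; apply: aopen_open; exact: dom_open|].
exact: coord_smooth.
Qed.

Lemma tangent_point_eq (p q : tangent_bundle M) : base p = base q -> vec p = vec q -> p = q.
Proof.
case: p q => [x v vP] [y w wP] /= xy vw; subst y w.
by congr TangentPoint; exact: Prop_irrelevance.
Qed.

Variable M' : set (tangent_bundle M).
Hypothesis oM' : aopen (tangent_charts M) M'.
Local Notation A' := (sub_charts M').

Lemma lsubmx_coord (p : M') a :
  lsubmx (chart_coord (a : chart_index A') p) = chart_coord a (base (val p)).
Proof. by rewrite /= row_mxKl. Qed.

Lemma rsubmx_coord (p : M') a :
  rsubmx (chart_coord (a : chart_index A') p) = \row_i vec (val p) (cfun a i).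
Proof. by rewrite /= row_mxKr. Qed.

(** The first [m] coordinates determine the base point; the last [m] are the values of the vector on
    coordinate functions, which determine it by [tangentP]. *)
Lemma sub_charts_inj (a : chart_index A') (p q : M') : chart_dom a p -> chart_dom a q ->
  chart_coord a p = chart_coord a q -> p = q.
Proof.
move=> dp dq E.
have Eb : base (val p) = base (val q).
  by apply: (@coord_inj _ _ M a) => //; rewrite -!lsubmx_coord E.
apply/val_inj/tangent_point_eq => //; apply/funext => f.
rewrite (proj1 (tangentP _ _ (dp : chart_dom (a : chart_index (charts M)) _)) (vecP (val p))).
rewrite (proj1 (tangentP _ _ (dq : chart_dom (a : chart_index (charts M)) _)) (vecP (val q))).
have /rowP Er : rsubmx (chart_coord a p) = rsubmx (chart_coord a q) by rewrite E.
apply: eq_bigr => i _; have := Er i; rewrite !rsubmx_coord !mxE => ->.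
by rewrite Eb.
Qed.

Lemma lsubmx_continuous : continuous (lsubmx : 'rV[R]_(m + m) -> 'rV[R]_m).
Proof. by move=> z; apply: differentiable_continuous; exact: differentiable_lsubmx. Qed.

(** In coordinates the projection to [M] is [lsubmx], so the image is the open image of [M'] cut by
    the preimage of an open set. *)
Lemma base_aopen (O : set M) : aopen (charts M) O ->
  aopen A' [set p | O (base (val p))].
Proof.
move=> oO a.
have -> : chart_coord a @` ([set p : M' | O (base (val p))] `&` chart_dom a) =
  (chart_coord (a : chart_index (tangent_charts M)) @`
     (M' `&` chart_dom (a : chart_index (tangent_charts M)))) `&`
  lsubmx @^-1` (chart_coord (a : chart_index (charts M)) @`
     (O `&` chart_dom (a : chart_index (charts M)))).
  apply/seteqP; split=> z.
    move=> [p [Op dp] <-]; split.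
      by exists (val p) => //; split=> //; exact: set_valP.
    by exists (base (val p)) => //; rewrite /= row_mxKl.
  move=> [[p [M'p dp] <-] [x [Ox dx]]]; rewrite /= row_mxKl => Ex.
  have xp := coord_inj dx dp Ex.
  exists (exist _ p (mem_set M'p)) => //; split=> //=.
  by rewrite -xp.
apply: openI; first exact: oM'.
by move/continuousP : lsubmx_continuous; apply; exact: oO.
Qed.

(** The induced coordinates transform by [x' = x'(x)] and [y'^i = sum_j y^j dx'^i/dx^j]; the two
    cases for [i] are these two formulas. *)
Lemma sub_coord_smooth (b : chart_index A') i :
  smooth_on A' (chart_dom b) (fun p => chart_coord b p 0 i).
Proof.
move=> a k; apply/CkP.
  by apply: base_aopen; apply: aopen_open; exact: dom_open.
move=> _ [p [dbp dap] <-].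
have oV : open (chart_coord a @` (chart_dom b `&` chart_dom a)).
  by apply: base_aopen; apply: aopen_open; exact: dom_open.
have nV : nbhs (chart_coord a p) (chart_coord a @` (chart_dom b `&` chart_dom a)).
  by apply: open_nbhs_nbhs; split=> //; exists p.
have dap' : chart_dom (a : chart_index (charts M)) (base (val p)) := dap.
have lE q : chart_dom a q -> local_expr a (fun p => chart_coord b p 0 i) (chart_coord a q)
    = chart_coord b q 0 i.
  by move=> dq; apply: local_expr_coord => // q' dq'; exact: sub_charts_inj.
have [i0 Ei|i0 Ei] := split_ordP i.
- pose f := cfun (b : chart_index (charts M)) i0.
  apply: (@ck_at_eq _ _ _ _ (fun z => local_expr (a : chart_index (charts M)) f (lsubmx z))).
    apply: filterS nV => _ [q [dbq daq] <-]; rewrite lE// lsubmx_coord.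
    by rewrite local_exprE// Ei /= row_mxEl.
  apply: ck_at_comp => [j|].
    by apply: ck_at_eq (ck_at_coord k _ (lshift m j)); apply: filterE => z; rewrite mxE.
  rewrite lsubmx_coord.
  apply: smooth_near_ck => //.
  exact: (cfun_smooth _ i0 (dbp : chart_dom (b : chart_index (charts M)) _)).
- pose f := cfun (b : chart_index (charts M)) i0.
  apply: (@ck_at_eq _ _ _ _ (fun z => \sum_j z 0 (rshift m j) *
     pd j (local_expr (a : chart_index (charts M)) f) (lsubmx z))).
    apply: filterS nV => _ [q [dbq daq] <-]; rewrite lE//.
    have daq' : chart_dom (a : chart_index (charts M)) (base (val q)) := daq.
    rewrite Ei [RHS]/= row_mxEr mxE -/f.
    rewrite [RHS](proj1 (tangentP _ _ daq') (vecP (val q))).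
    apply: eq_bigr => j _; rewrite lsubmx_coord partialE; last first.
      exact: (cfun_smooth _ i0 (dbq : chart_dom (b : chart_index (charts M)) _)).
    by congr (_ * _); rewrite /= row_mxEr mxE.
  apply: ck_at_sum => j _; apply: ck_at_mul; first exact: ck_at_coord.
  apply: ck_at_comp => [j'|].
    by apply: ck_at_eq (ck_at_coord k _ (lshift m j')); apply: filterE => z; rewrite mxE.
  rewrite lsubmx_coord; apply: ck_at_pd.
  apply: smooth_near_ck => //.
  exact: (cfun_smooth _ i0 (dbp : chart_dom (b : chart_index (charts M)) _)).
Qed.

Lemma sub_smooth_atlas : smooth_atlas A'.
Proof.
split; [|exact: sub_charts_inj| |exact: sub_coord_smooth].
  by move=> p; exact: (dom_cover (base (val p))).
by move=> a; apply: base_aopen; apply: aopen_open; exact: dom_open.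
Qed.

(** Chart domains of [M'] are preimages of domains in [M], so the two points lie over distinct base
    points; open sets separating these are pulled back. *)
Lemma sub_charts_separated (a : chart_index A') p q : chart_dom a p -> ~ chart_dom a q ->
  exists O Q, [/\ aopen A' O, aopen A' Q, O p, Q q & O `&` Q `<=` set0].
Proof.
move=> dp ndq; have pq : base (val p) != base (val q).
  by apply: contra_notN ndq => /eqP E; rewrite /= -E.
have := @manifold_hausdorff _ _ M; rewrite open_hausdorff.
move=> /(_ _ _ pq) [[U V] /= [Up Vq] [oU oV UV]].
exists [set r | U (base (val r))], [set r | V (base (val r))]; split.
- exact/base_aopen/aopen_open.
- exact/base_aopen/aopen_open.
- exact: set_mem.
- exact: set_mem.
- move=> r [Ur Vr]; have : (U `&` V) (base (val r)) by [].
  by rewrite (_ : U `&` V = set0)//; apply/eqP.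
Qed.
End TangentAtlas.

(** * The vertical bundle *)

Section Vertical.
Context {R : realType} {m : nat} {M : manifold R m} (M' : set (tangent_bundle M)).
Hypothesis oM' : aopen (tangent_charts M) M'.
Local Notation A' := (sub_charts M').
Implicit Types (a : chart_index A') (p q : M') (U W Z : field R M').

#[local] Instance sA' : smooth_atlas A' := sub_smooth_atlas oM'.

Definition ycoord a (i : 'I_m) : M' -> R := cfun a (rshift m i).

Lemma cfun_pi a i : cfun a (lshift m i) =
  (cfun (a : chart_index (charts M)) i) \o @pi_M _ _ _ M'.
Proof. by apply/funext => q; rewrite /cfun /= row_mxEl. Qed.

(** A displacement in [y] leaves the first [m] coordinates unchanged, so the difference quotient is
    identically 0. *)
Lemma d_dy_pi a i p f : chart_dom a p -> d_dy a i p (f \o @pi_M _ _ _ M') = 0.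
Proof.
move=> dp; have [sf|nf] := pselect (smooth_near A' p (f \o @pi_M _ _ _ M')); last first.
  exact: partial_ns.
rewrite /d_dy partialE//.
rewrite (@near_eq_pd _ _ _ _ _ (local_expr (a : chart_index (charts M)) f \o lsubmx)); last first.
  apply: filterS (anbhs_chart sA' dp (anbhs_dom sA' dp)) => z [q [dq <- _]].
  rewrite local_exprE//= row_mxKl local_expr_coord //.
  by move=> x dx; exact: coord_inj.
rewrite -pdE /derive.
rewrite (_ : (fun h : R => _) = fun=> 0); first by apply: cvg_lim => //; exact: cvg_cst.
apply/funext => h; rewrite /comp /=.
have -> : lsubmx (h *: ('e_(rshift m i) : 'rV[R]_(m + m)) + chart_coord a p) =
    lsubmx (chart_coord a p).
  by apply/rowP => j; rewrite !mxE eqxx eq_lrshift mulr0 add0r.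
by rewrite subrr scaler0.
Qed.

Lemma tangent_split a p w f : chart_dom a p -> tangent A' p w ->
  w f = \sum_i w (cfun a (lshift m i)) * d_dx a i p f +
        \sum_i w (ycoord a i) * d_dy a i p f.
Proof. by move=> dp tw; rewrite [LHS](proj1 (tangentP sA' _ dp) tw) big_split_ord. Qed.

(** Turns the kernel of the differential of the projection into [m] linear equations in a single
    chart. *)
Lemma verticalP a p w : chart_dom a p ->
  vertical p w <-> tangent A' p w /\ forall i, w (cfun a (lshift m i)) = 0.
Proof.
move=> dp; have dp' : chart_dom (a : chart_index (charts M)) (base (val p)) := dp.
split=> [[tw dw]|[tw w0]]; split=> //.
  move=> i; have : differential_at (charts M) (@pi_M _ _ _ M') p w
      (cfun (a : chart_index (charts M)) i) = 0 by rewrite dw.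
  rewrite /differential_at asboolT; first by rewrite cfun_pi.
  exact: cfun_smooth.
apply/funext => f; rewrite /differential_at; case: asboolP => // sf.
rewrite (tangent_split _ dp tw) -[RHS]addr0; congr (_ + _); apply: big1 => i _.
  by rewrite w0; exact: mul0r.
by rewrite (d_dy_pi _ _ dp); exact: mulr0.
Qed.

Lemma vertical_tangent p w : vertical p w -> tangent A' p w.
Proof. by case. Qed.

Lemma vertical_lin p c u w : vertical p u -> vertical p w -> vertical p (c \*o u + w).
Proof.
have [a dp] := atlas_cover sA' p; move=> /(verticalP _ dp) [tu u0] /(verticalP _ dp) [tw w0].
apply/(verticalP _ dp); split; first exact: tangentD.
by move=> i; rewrite fctE /= u0 w0 mulr0 addr0.
Qed.

Lemma vertical0 p : vertical p 0.
Proof.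
have [a dp] := atlas_cover sA' p.
by apply/(verticalP _ dp); split => //; exact: tangent0.
Qed.

Lemma vertical_scale p c u : vertical p u -> vertical p (c \*o u).
Proof. by move=> vu; have := vertical_lin c vu (vertical0 p); rewrite addr0. Qed.

Lemma vertical_add p u w : vertical p u -> vertical p w -> vertical p (u + w).
Proof.
move=> vu vw; have := vertical_lin 1 vu vw; congr vertical; apply/funext => f.
by rewrite !fctE /= mul1r.
Qed.

Lemma vertical_opp p u : vertical p u -> vertical p (- u).
Proof.
move=> /(vertical_scale (-1)); congr vertical; apply/funext => f.
by rewrite /= mulN1r.
Qed.

Lemma vertical_sub p u w : vertical p u -> vertical p w -> vertical p (u - w).
Proof. by move=> vu vw; apply: vertical_add => //; exact: vertical_opp. Qed.

Lemma vertical_sum p (I : Type) (r : seq I) (P : pred I) (c : I -> R) (u : I -> vect R M') :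
  (forall i, vertical p (u i)) -> vertical p (\sum_(i <- r | P i) (c i \*o u i)).
Proof.
move=> H; elim/big_ind: _ => [|u' w tu tw|i _]; [exact: vertical0|exact: vertical_add|].
exact: vertical_scale.
Qed.

Lemma vertical_d_dy a i p : chart_dom a p -> vertical p (d_dy a i p).
Proof.
move=> dp; apply/(verticalP _ dp); split; first exact: tangent_partial.
by move=> j; rewrite /d_dy partial_cfun// eq_rlshift.
Qed.

Lemma vertical_expand a p w : chart_dom a p -> vertical p w ->
  w = \sum_i (w (ycoord a i) \*o d_dy a i p).
Proof.
move=> dp /(verticalP _ dp) [tw w0]; apply/funext => f; rewrite fct_sumE /=.
rewrite (tangent_split _ dp tw) [X in X + _]big1 => [|i _]; last by rewrite w0 mul0r.
exact: add0r.
Qed.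

Lemma d_dy_ycoord a i j p : chart_dom a p -> d_dy a i p (ycoord a j) = (i == j)%:R.
Proof. by move=> dp; rewrite /d_dy partial_cfun// eq_rshift. Qed.

Lemma sum_d_dy_ycoord a p (c : 'I_m -> R) j : chart_dom a p ->
  (\sum_i (c i \*o d_dy a i p)) (ycoord a j) = c j.
Proof.
move=> dp; rewrite fct_sumE (bigD1 j)//= d_dy_ycoord// eqxx mulr1 big1 ?addr0// => i ij.
by rewrite d_dy_ycoord// (negbTE ij) mulr0.
Qed.

Lemma vsection_vfield U : vsection U -> vfield A' U.
Proof. by case. Qed.

Lemma vsection_vertical U p : vsection U -> vertical p (U p).
Proof. by case=> _; apply. Qed.

Lemma vsectionD U W : vsection U -> vsection W -> vsection (U + W).
Proof.
by move=> [vU U0] [vW W0]; split; [exact: vfieldD|move=> p; exact: vertical_add].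
Qed.

Lemma vsectionN U : vsection U -> vsection (- U).
Proof. by move=> [vU U0]; split; [exact: vfieldN|move=> p; exact: vertical_opp]. Qed.

Lemma vsectionB U W : vsection U -> vsection W -> vsection (U - W).
Proof. by move=> vU vW; apply: vsectionD => //; exact: vsectionN. Qed.

Lemma vsection0 : vsection (0 : field R M').
Proof. by split; [exact: vfield0|move=> p; exact: vertical0]. Qed.

Lemma vsectionZ f U : smooth A' f -> vsection U -> vsection (fscale f U).
Proof. by move=> sf [vU U0]; split; [exact: vfieldZ|move=> p; exact: vertical_scale]. Qed.

Lemma vsection_sum (I : Type) (r : seq I) (P : pred I) (U : I -> field R M') :
  (forall i, vsection (U i)) -> vsection (\sum_(i <- r | P i) U i).
Proof. by move=> H; elim/big_ind: _ => //; [exact: vsection0|exact: vsectionD]. Qed.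

Lemma ycoord_smooth a p i : chart_dom a p -> smooth_near A' p (ycoord a i).
Proof. exact: cfun_smooth. Qed.

Lemma vsection_intro U : (forall p, vertical p (U p)) ->
  (forall p, exists2 a : chart_index A', chart_dom a p &
    forall i, smooth_near A' p (act U (ycoord a i))) -> vsection U.
Proof.
move=> U0 sU; split => //; apply: vfield_intro => [p|p]; first exact: vertical_tangent.
have [a dp sUi] := sU p; exists a => // i.
have [j ->|j ->] := split_ordP i; last exact: sUi.
apply: smooth_near_eq (smooth_near_cst sA' p 0); apply: filterS (anbhs_dom sA' dp) => q dq.
by have [_ H] := proj1 (verticalP _ dq) (U0 q); rewrite /act H.
Qed.

Definition is_bump a p (b : M' -> R) :=
  [/\ chart_dom a p, smooth A' b, anbhs A' p (fun q => b q = 1) &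
      forall q, ~ chart_dom a q -> anbhs A' q (fun q' => b q' = 0)].

Lemma ex_bump p : exists a b, is_bump a p b.
Proof.
have [a dp] := atlas_cover sA' p; exists a.
by have [b [? ? ?]] := exists_bump sA' (sub_charts_separated oM') dp; exists b.
Qed.

Lemma bump_smooth a p b h : is_bump a p b ->
  (forall q, chart_dom a q -> smooth_near A' q h) -> smooth A' (fun q => b q * h q).
Proof.
move=> [dp sb b1 b0] sh q; have [dq|ndq] := pselect (chart_dom a q).
  by apply: smooth_near_mul; [exact: sb|exact: sh].
apply: smooth_near_eq (smooth_near_cst sA' q 0); apply: filterS (b0 q ndq) => q' ->.
by rewrite mul0r.
Qed.

(** A global substitute for the local frame: operators on sections are constrained on global
    sections only. The bump also kills the meaningless values of [d_dy a i] outside the chart. *)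
Definition dy_ext a (b : M' -> R) (i : 'I_m) : field R M' := fscale b (d_dy a i).

Lemma dy_ext_vsection a p b i : is_bump a p b -> vsection (dy_ext a b i).
Proof.
move=> B; have [dp sb b1 b0] := B; split.
  split=> [q _|q f _ sf]; have [dq|ndq] := pselect (chart_dom a q).
  - by apply: tangent_scale; exact: tangent_partial.
  - have bq := anbhs_singleton (b0 q ndq).
    rewrite (_ : dy_ext a b i q = 0); first exact: tangent0.
    by apply/funext => f; rewrite /dy_ext fscaleE bq mul0r.
  - by apply: (smooth_near_mul _ (g := act (d_dy a i) f)); [exact: sb|exact: partial_smooth].
  - apply: smooth_near_eq (smooth_near_cst sA' q 0); apply: filterS (b0 q ndq) => q' bq.
    by rewrite /act /dy_ext fscaleE bq mul0r.
move=> q; have [dq|ndq] := pselect (chart_dom a q).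
  by apply: vertical_scale; exact: vertical_d_dy.
have bq := anbhs_singleton (b0 q ndq).
rewrite (_ : dy_ext a b i q = 0); first exact: vertical0.
by apply/funext => f; rewrite /dy_ext fscaleE bq mul0r.
Qed.

Lemma vertical_extend p w : vertical p w -> exists2 W, vsection W & W p = w.
Proof.
move=> vw; have [a [b B]] := ex_bump p; have [dp sb b1 b0] := B.
exists (\sum_i fscale (fun=> w (ycoord a i)) (dy_ext a b i)).
  apply: vsection_sum => i; apply: vsectionZ; last exact: dy_ext_vsection B.
  by move=> q; exact: smooth_near_cst.
rewrite [RHS](vertical_expand dp vw); apply/funext => f; rewrite !fct_sumE.
apply: eq_bigr => i _; rewrite fscaleE /dy_ext fscaleE.
by rewrite (anbhs_singleton b1) mul1r.
Qed.

(** * Maps on sections that are linear over functions act pointwise *)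

Section Tensorial.
Variable L : field R M' -> M' -> R.
Hypothesis LD : forall Z Z', vsection Z -> vsection Z' ->
  forall p, L (Z + Z') p = L Z p + L Z' p.
Hypothesis LZ : forall f Z, smooth A' f -> vsection Z ->
  forall p, L (fscale f Z) p = f p * L Z p.

Lemma tensorial0 p : L 0 p = 0.
Proof.
by have := LD vsection0 vsection0 p; rewrite addr0 => /eqP; rewrite eq_sym -subr_eq0 addrK => /eqP.
Qed.

Lemma tensorial_sum (I : Type) (r : seq I) (U : I -> field R M') p :
  (forall i, vsection (U i)) -> L (\sum_(i <- r) U i) p = \sum_(i <- r) L (U i) p.
Proof.
move=> H; elim: r => [|i r IH]; first by rewrite !big_nil tensorial0.
by rewrite !big_cons LD ?IH//; exact: vsection_sum.
Qed.

(* [b^2 Z] is a combination of the global sections [b d/dy^i] with the globally smooth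
   coefficients [b Z^i]. *)
Lemma tensorial_local a p b : is_bump a p b -> forall q, b q = 1 -> chart_dom a q ->
  forall Z, vsection Z -> L Z q = \sum_i Z q (ycoord a i) * L (dy_ext a b i) q.
Proof.
move=> B; have [dp sb b1 b0] := B => q bq dq Z vZ.
have sbb : smooth A' (fun q => b q * b q) by move=> r; apply: smooth_near_mul; exact: sb.
have E : fscale (fun q => b q * b q) Z =
    \sum_i fscale (fun q => b q * act Z (ycoord a i) q) (dy_ext a b i).
  apply/funext => r; apply/funext => f; rewrite fscaleE !fct_sumE.
  have [dr|ndr] := pselect (chart_dom a r); last first.
    rewrite (anbhs_singleton (b0 r ndr)) !mul0r big1// => i _.
    by rewrite fscaleE (anbhs_singleton (b0 r ndr)) !mul0r.
  rewrite [in LHS](vertical_expand dr (vsection_vertical r vZ)) fct_sumE mulr_sumr.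
  apply: eq_bigr => i _; rewrite fscaleE /dy_ext fscaleE /act /=; ring.
have sZ i : smooth A' (fun q => b q * act Z (ycoord a i) q).
  apply: bump_smooth B _ => r dr; apply: vfield_smooth; first exact: vsection_vfield.
  exact: ycoord_smooth.
have := LZ sbb vZ q; rewrite bq !mul1r => <-; rewrite E tensorial_sum; last first.
  by move=> i; apply: vsectionZ => //; exact: dy_ext_vsection B.
apply: eq_bigr => i _; rewrite LZ//; last exact: dy_ext_vsection B.
by rewrite bq mul1r.
Qed.
End Tensorial.
End Vertical.

(** * The Finsler metric and Koszul connections *)

Section FinslerMetric.
Context {R : realType} {m q : nat} {M : manifold R m} {M' : set (tangent_bundle M)}.
Variables (F : M' -> R) (hF : pseudo_finsler q F).
Variables (g : M' -> vect R M' -> vect R M' -> R) (hg : vertical_metric F g).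
Local Notation A' := (sub_charts M').
Implicit Types (a : chart_index A') (p r : M') (U W Z : field R M') (u w : vect R M').

Let oM' : aopen (tangent_charts M) M' := pf_open hF.
Let sM' : smooth_atlas A' := sub_smooth_atlas oM'.
#[local] Existing Instance sM'.

Lemma g_mx_sym a p i j : chart_dom a p -> g_mx F a p i j = g_mx F a p j i.
Proof.
move=> dp; rewrite mxE mxE.
have -> // : d_dy a i p (act (d_dy a j) F) = d_dy a j p (act (d_dy a i) F).
exact: (partial_comm sM' _ _ dp (pf_smooth hF p)).
Qed.

Lemma g_mx_smooth a p i j : chart_dom a p -> smooth_near A' p (fun r => g_mx F a r i j).
Proof.
move=> dp; have H : smooth_near A' p (fun r => 2^-1 * act (d_dy a i) (act (d_dy a j) F) r).
  apply: (smooth_near_mul sM'); first exact: smooth_near_cst.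
  apply: (partial_smooth sM') => //; apply: (partial_smooth sM') => //; exact: (pf_smooth hF).
by apply: smooth_near_eq H; apply: filterE => r; rewrite mxE.
Qed.

(** Negative and positive roots together number [m], so 0 is no root; up to sign the determinant is
    the characteristic polynomial at 0. *)
Lemma has_index_det k (G : 'M[R]_m) : (k <= m)%N -> has_index k G -> \det G != 0.
Proof.
move=> km [d [chG Neg Pos]].
have d0 i : d i != 0.
  apply/negP => /eqP di0.
  pose N := [pred i | d i < 0]; pose P := [pred i | 0 < d i].
  (* A zero root would be neither negative nor positive, making the positive roots a proper part of
     the non-negative ones. *)
  have : (#|P| < #|predC N|)%N.
    apply/proper_card/properP; split.
      by apply/fintype.subsetP => j; rewrite !inE => /ltW; rewrite leNgt.
    by exists i; rewrite !inE di0 ltxx.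
  have := cardC N; rewrite Neg card_ord => E.
  by rewrite Pos -(congr1 (fun l => l - k)%N E) addKn ltnn.
have := char_poly_det G; rewrite -horner_coef0 chG horner_prod => E.
have : \prod_i ('X - (d i)%:P).[0] != 0.
  by apply/prodf_neq0 => i _; rewrite !hornerE oppr_eq0.
by rewrite E mulf_eq0 negb_or => /andP[].
Qed.

Lemma g_mx_det a p : chart_dom a p -> \det (g_mx F a p) != 0.
Proof.
move=> dp; apply: (@has_index_det q); last exact: (pf_signature hF).
by have /andP[_ /ltnW] := pf_index hF.
Qed.

Lemma g0l p w : vertical p w -> g p 0 w = 0.
Proof.
move=> vw; have v0 := vertical0 oM' p.
have := vm_linear_l hg 1 v0 v0 vw; rewrite (_ : 1 \*o 0 + 0 = 0 :> vect R M').
  by rewrite mul1r => /eqP; rewrite eq_sym -subr_eq0 addrK => /eqP.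
by apply/funext => f; rewrite fctE /= mulr0 addr0.
Qed.

Lemma g0r p w : vertical p w -> g p w 0 = 0.
Proof.
move=> vw; have v0 := vertical0 oM' p.
have := vm_linear_r hg 1 vw v0 v0; rewrite (_ : 1 \*o 0 + 0 = 0 :> vect R M').
  by rewrite mul1r => /eqP; rewrite eq_sym -subr_eq0 addrK => /eqP.
by apply/funext => f; rewrite fctE /= mulr0 addr0.
Qed.

Lemma g_suml p (I : Type) (s : seq I) (c : I -> R) (v : I -> vect R M') w :
  (forall i, vertical p (v i)) -> vertical p w ->
  g p (\sum_(i <- s) (c i \*o v i)) w = \sum_(i <- s) c i * g p (v i) w.
Proof.
move=> vv vw; elim: s => [|i s IH]; first by rewrite !big_nil g0l.
by rewrite !big_cons (vm_linear_l hg)// ?IH//; exact: vertical_sum.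
Qed.

Lemma g_sumr p (I : Type) (s : seq I) (c : I -> R) (v : I -> vect R M') w :
  (forall i, vertical p (v i)) -> vertical p w ->
  g p w (\sum_(i <- s) (c i \*o v i)) = \sum_(i <- s) c i * g p w (v i).
Proof.
move=> vv vw; elim: s => [|i s IH]; first by rewrite !big_nil g0r.
by rewrite !big_cons (vm_linear_r hg)// ?IH//; exact: vertical_sum.
Qed.

Lemma gE a p u w : chart_dom a p -> vertical p u -> vertical p w ->
  g p u w = \sum_i \sum_j u (ycoord a i) * w (ycoord a j) * g_mx F a p i j.
Proof.
move=> dp vu vw; rewrite [in LHS](vertical_expand oM' dp vu).
have vd i : vertical p (d_dy a i p) by exact: vertical_d_dy.
rewrite g_suml//; apply: eq_bigr => i _.
rewrite [in LHS](vertical_expand oM' dp vw) g_sumr// mulr_sumr; apply: eq_bigr => j _.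
by rewrite (vm_frame hg)// mulrA.
Qed.

Lemma g_sym p u w : vertical p u -> vertical p w -> g p u w = g p w u.
Proof.
move=> vu vw; have [a dp] := atlas_cover sM' p; rewrite !(gE dp)//.
rewrite exchange_big /=; apply: eq_bigr => i _; apply: eq_bigr => j _.
by rewrite g_mx_sym// [w _ * _]mulrC.
Qed.

Lemma g_lincomb a p (c : 'I_m -> R) w : chart_dom a p -> vertical p w ->
  g p (\sum_i (c i \*o d_dy a i p)) w =
  \sum_j ((\row_i c i) *m g_mx F a p) 0 j * w (ycoord a j).
Proof.
move=> dp vw; rewrite (gE dp)//; last by apply: vertical_sum => // i; exact: vertical_d_dy.
rewrite exchange_big; apply: eq_bigr => j _ /=.
rewrite mxE mulr_suml; apply: eq_bigr => i _.
by rewrite sum_d_dy_ycoord// [(\row__ _) _ _]mxE mulrAC.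
Qed.

Lemma g_nondegenerate p u : vertical p u -> (forall w, vertical p w -> g p u w = 0) -> u = 0.
Proof.
move=> vu H; have [a dp] := atlas_cover sM' p.
rewrite (vertical_expand oM' dp vu); pose c i := u (ycoord a i).
have E : (\row_i c i) *m g_mx F a p = 0.
  apply/rowP => j; have := H (d_dy a j p) (vertical_d_dy oM' j dp).
  rewrite (vertical_expand oM' dp vu) g_lincomb//; last exact: vertical_d_dy.
  rewrite (bigD1 j)//= d_dy_ycoord// eqxx mulr1 big1 ?addr0 ?mxE//.
  by move=> i ij; rewrite d_dy_ycoord// eq_sym (negbTE ij) mulr0.
have c0 : \row_i c i = 0.
  have U : g_mx F a p \in unitmx by rewrite unitmxE unitfE g_mx_det.
  by rewrite -(mulmxK U (\row_i c i)) E mul0mx.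
rewrite big1// => i _; apply/funext => f /=.
by have /rowP/(_ i) := c0; rewrite !mxE /c => ->; rewrite mul0r.
Qed.

Definition gpair U W p := g p (U p) (W p).

Lemma gpair_smooth U W : vsection U -> vsection W -> smooth A' (gpair U W).
Proof.
move=> vU vW p; have [a dp] := atlas_cover sM' p.
have H : smooth_near A' p (fun r => \sum_i \sum_j
    act U (ycoord a i) r * act W (ycoord a j) r * g_mx F a r i j).
  apply: (smooth_near_sum sM') => i _; apply: (smooth_near_sum sM') => j _.
  apply: (smooth_near_mul sM'); last exact: g_mx_smooth.
  by apply: (smooth_near_mul sM'); apply: vfield_smooth; (exact: vsection_vfield || exact: ycoord_smooth).
apply: smooth_near_eq H; apply: filterS (anbhs_dom sM' dp) => r dr.
by rewrite /gpair (gE dr); [|exact: vsection_vertical|exact: vsection_vertical].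
Qed.

(** Reduces the identities for the Koszul operator to scalar identities. Every vertical vector
    extends to a global section, so global test sections suffice. *)
Lemma gpair_inj U U' : vsection U -> vsection U' ->
  (forall Z, vsection Z -> gpair U Z = gpair U' Z) -> U = U'.
Proof.
move=> vU vU' H; apply/funext => p; apply/eqP; rewrite -subr_eq0; apply/eqP.
have vp := vsection_vertical p vU; have vp' := vsection_vertical p vU'.
apply: (@g_nondegenerate p); first exact: vertical_sub.
move=> w vw; have [Z vZ <-] := vertical_extend oM' vw.
have vZp := vsection_vertical p vZ.
have -> : U p - U' p = -1 \*o U' p + U p.
  by apply/funext => f; rewrite /= !fctE /= mulN1r addrC.
rewrite (vm_linear_l hg)//; have := congr1 (fun h => h p) (H Z vZ).
by rewrite /gpair => ->; rewrite mulN1r addNr.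
Qed.

Lemma invmx_smooth a p i j : chart_dom a p ->
  smooth_near A' p (fun r => invmx (g_mx F a r) i j).
Proof.
move=> dp.
have H : smooth_near A' p (fun r => (\det (g_mx F a r))^-1 *
    ((-1) ^+ (j + i) * \det (row' j (col' i (g_mx F a r))))).
  apply: (smooth_near_mul sM').
    apply: (smooth_near_inv sM'); first exact: g_mx_det.
    by apply: (smooth_near_det sM') => k l; exact: g_mx_smooth.
  apply: (smooth_near_mul sM'); first exact: smooth_near_cst.
  apply: (smooth_near_det sM') => k l.
  apply: smooth_near_eq (g_mx_smooth (lift j k) (lift i l) dp).
  by apply: filterE => r; rewrite !mxE.
apply: smooth_near_eq H; apply: filterS (anbhs_dom sM' dp) => r dr.
by rewrite /invmx unitmxE unitfE g_mx_det// !mxE.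
Qed.

(** Raising an index: in a chart the section has components [L(d/dy^j) g^(ji)], smooth by Cramer's
    rule. *)
Lemma musical (L : field R M' -> M' -> R) :
  (forall Z, vsection Z -> smooth A' (L Z)) ->
  (forall Z Z', vsection Z -> vsection Z' -> forall p, L (Z + Z') p = L Z p + L Z' p) ->
  (forall f Z, smooth A' f -> vsection Z -> forall p, L (fscale f Z) p = f p * L Z p) ->
  exists2 U, vsection U & forall Z, vsection Z -> gpair U Z = L Z.
Proof.
move=> sL LD LZ.
pose c a b r := (\row_j L (dy_ext a b j) r) *m invmx (g_mx F a r).
pose u a b r := \sum_i (c a b r 0 i \*o d_dy a i r).
have key a b p : is_bump a p b -> forall r, b r = 1 -> chart_dom a r ->
    vertical r (u a b r) /\ forall Z, vsection Z -> g r (u a b r) (Z r) = L Z r.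
  move=> B r br dr; split; first by apply: vertical_sum => // i; exact: vertical_d_dy.
  move=> Z vZ; rewrite (tensorial_local oM' LD LZ B br dr vZ) g_lincomb//; last exact: vsection_vertical.
  rewrite (_ : \row_i c a b r 0 i = c a b r); last by apply/rowP => i; rewrite mxE.
  rewrite /c mulmxKV; last by rewrite unitmxE unitfE g_mx_det.
  by apply: eq_bigr => i _; rewrite mxE mulrC.
pose S r := [set v | vertical r v /\ forall Z, vsection Z -> g r v (Z r) = L Z r].
(* Charts and bumps vary with [r] without control; since nondegeneracy makes the solution at [r]
   unique, the choice is immaterial. *)
pose U : field R M' := fun r => xget 0 (S r).
have SU r : S r (U r).
  have [a [b B]] := ex_bump oM' r; have [dr _ br _] := B.
  by apply: (@xgetPex _ 0 (S r)); exists (u a b r); exact: (key a b r B r (anbhs_singleton br) dr).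
have S_uniq r v v' : S r v -> S r v' -> v = v'.
  move=> [vv Sv] [vv' Sv']; apply/eqP; rewrite -subr_eq0; apply/eqP.
  apply: (@g_nondegenerate r); first exact: vertical_sub.
  move=> w vw; have [Z vZ <-] := vertical_extend oM' vw.
  have vZp := vsection_vertical r vZ.
  have -> : v - v' = -1 \*o v' + v.
    by apply/funext => f; rewrite /= !fctE /= mulN1r addrC.
  by rewrite (vm_linear_l hg)// Sv// Sv'// mulN1r addNr.
exists U; last by move=> Z vZ; apply/funext => r; have [_] := SU r; exact.
apply: (vsection_intro oM') => [r|p]; first by have [] := SU r.
have [a [b B]] := ex_bump oM' p; have [dp _ bp _] := B; exists a => // i.
have H : smooth_near A' p (fun r => \sum_j L (dy_ext a b j) r * invmx (g_mx F a r) j i).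
  apply: (smooth_near_sum sM') => j _; apply: (smooth_near_mul sM'); last exact: invmx_smooth.
  by apply: sL; exact: dy_ext_vsection B.
(* Near [p] a single chart and bump serve all points, so the chosen vectors are given by one smooth
   formula. *)
apply: smooth_near_eq H; apply: filterS (filterI bp (anbhs_dom sM' dp)) => r [br dr].
rewrite /act (S_uniq r _ _ (SU r) (key a b p B r br dr)) /u sum_d_dy_ycoord// /c mxE.
by apply: eq_bigr => j _; rewrite mxE.
Qed.

Lemma gpairDl U W Z p : vsection U -> vsection W -> vsection Z ->
  gpair (U + W) Z p = gpair U Z p + gpair W Z p.
Proof.
move=> vU vW vZ; rewrite /gpair -[LHS]/(g p (U p + W p) (Z p)).
have -> : U p + W p = 1 \*o U p + W p by apply/funext => f; rewrite !fctE /= mul1r.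
by rewrite (vm_linear_l hg) ?mul1r//; exact: vsection_vertical.
Qed.

Lemma gpairZl f U Z p : vsection U -> vsection Z ->
  gpair (fscale f U) Z p = f p * gpair U Z p.
Proof.
move=> vU vZ; rewrite /gpair -[fscale f U p]/(f p \*o U p).
have -> : f p \*o U p = f p \*o U p + 0 by rewrite addr0.
rewrite (vm_linear_l hg) ?g0l ?addr0//; try exact: vsection_vertical.
exact: vertical0.
Qed.

Lemma gpairC U Z p : vsection U -> vsection Z -> gpair U Z p = gpair Z U p.
Proof. by move=> vU vZ; rewrite /gpair g_sym//; exact: vsection_vertical. Qed.

Lemma gpairDr U W Z p : vsection U -> vsection W -> vsection Z ->
  gpair Z (U + W) p = gpair Z U p + gpair Z W p.
Proof.
move=> vU vW vZ; rewrite gpairC//; last exact: (vsectionD oM').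
by rewrite gpairDl// gpairC// (gpairC p vW).
Qed.

Lemma gpairZr f U Z p : smooth A' f -> vsection U -> vsection Z ->
  gpair Z (fscale f U) p = f p * gpair Z U p.
Proof.
move=> sf vU vZ; rewrite gpairC//; last exact: (vsectionZ oM').
by rewrite gpairZl// gpairC.
Qed.

Lemma gpairNl U Z p : vsection U -> vsection Z -> gpair (- U) Z p = - gpair U Z p.
Proof.
move=> vU vZ; have -> : - U = fscale (fun=> -1) U.
  by apply/funext => r; apply/funext => f; rewrite fscaleE fieldNE mulN1r.
by rewrite gpairZl// mulN1r.
Qed.

Lemma actgD X U W Z p : vfield A' X -> vsection U -> vsection W -> vsection Z ->
  X p (gpair (U + W) Z) = X p (gpair U Z) + X p (gpair W Z).
Proof.
move=> vX vU vW vZ; rewrite -(tangent_addf sM' (vfield_tangent p vX)); try exact: gpair_smooth.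
by congr (X p _); apply/funext => r; exact: gpairDl.
Qed.

Lemma actgZ X f U Z p : vfield A' X -> smooth A' f -> vsection U -> vsection Z ->
  X p (gpair (fscale f U) Z) = f p * X p (gpair U Z) + gpair U Z p * X p f.
Proof.
move=> vX sf vU vZ; rewrite -(tangentM sM' (vfield_tangent p vX) (sf p)); last exact: gpair_smooth.
by congr (X p _); apply/funext => r; exact: gpairZl.
Qed.

Lemma actgC (X : field R M') U Z p : vsection U -> vsection Z -> X p (gpair U Z) = X p (gpair Z U).
Proof. by move=> vU vZ; congr (X p _); apply/funext => r; exact: gpairC. Qed.

(* The structure of a Lie algebroid on the vertical bundle, without the Jacobi identity. *)
Record anchored_bracket (rho : field R M' -> field R M')
    (B : field R M' -> field R M' -> field R M') : Prop := AnchoredBracket {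
  ab_vfield : forall U, vsection U -> vfield A' (rho U);
  ab_anchorD : forall U W, vsection U -> vsection W -> rho (U + W) = rho U + rho W;
  ab_anchorZ : forall f U, smooth A' f -> vsection U -> rho (fscale f U) = fscale f (rho U);
  ab_vsection : forall U W, vsection U -> vsection W -> vsection (B U W);
  ab_skew : forall U W, vsection U -> vsection W -> B U W = - B W U;
  ab_addr : forall U W Z, vsection U -> vsection W -> vsection Z ->
    B U (W + Z) = B U W + B U Z;
  ab_leibniz : forall f U W, smooth A' f -> vsection U -> vsection W ->
    B U (fscale f W) = fscale f (B U W) + fscale (act (rho U) f) W }.

(** * Koszul's formula for a bracket with anchor *)

Section Koszul.
Variables (rho : field R M' -> field R M') (B : field R M' -> field R M' -> field R M').
Hypothesis aB : anchored_bracket rho B.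

Let vD U W := @vsectionD _ _ _ _ oM' U W.
Let vZ f U := @vsectionZ _ _ _ _ oM' f U.
Let vB U W := @ab_vsection _ _ aB U W.

Let BDr U W Z Y p : vsection U -> vsection W -> vsection Z -> vsection Y ->
  gpair (B U (W + Z)) Y p = gpair (B U W) Y p + gpair (B U Z) Y p.
Proof.
by move=> vU vW vZ' vY; rewrite (ab_addr aB)// gpairDl//; exact: vB.
Qed.

Let BC U W Y p : vsection U -> vsection W -> vsection Y ->
  gpair (B U W) Y p = - gpair (B W U) Y p.
Proof. by move=> vU vW vY; rewrite (ab_skew aB)// gpairNl//; exact: vB. Qed.

Let BZr f U W Y p : smooth A' f -> vsection U -> vsection W -> vsection Y ->
  gpair (B U (fscale f W)) Y p = f p * gpair (B U W) Y p + rho U p f * gpair W Y p.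
Proof.
move=> sf vU vW vY; have sa : smooth A' (act (rho U) f).
  by move=> r; apply: vfield_smooth; [exact: (ab_vfield aB)|exact: sf].
rewrite (ab_leibniz aB)// gpairDl//; [|exact/vZ/vB|exact: vZ].
by rewrite gpairZl ?gpairZl//; exact: vB.
Qed.

(** This is [2 g(D_U W, Z)]: add the metric identities for [(U; W, Z)] and [(W; Z, U)], subtract the
    one for [(Z; U, W)], and express the differences [D_X Y - D_Y X] by [B]. *)
Definition koszul U W Z p :=
  rho U p (gpair W Z) + rho W p (gpair Z U) - rho Z p (gpair U W)
  + gpair (B U W) Z p - gpair (B U Z) W p - gpair (B W Z) U p.

Lemma koszul_smooth U W Z : vsection U -> vsection W -> vsection Z ->
  smooth A' (koszul U W Z).
Proof.
move=> vU vW vZ' p.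
have sr X Y Y' : vsection X -> vsection Y -> vsection Y' ->
    smooth_near A' p (act (rho X) (gpair Y Y')).
  by move=> vX vY vY'; apply: vfield_smooth; [exact: (ab_vfield aB)|exact: gpair_smooth].
have sg X X' Y : vsection X -> vsection X' -> vsection Y ->
    smooth_near A' p (gpair (B X X') Y).
  by move=> *; apply: gpair_smooth => //; exact: vB.
have s1 := smooth_near_add sM' (smooth_near_add sM' (sr U W Z vU vW vZ') (sr W Z U vW vZ' vU))
  (smooth_near_opp sM' (sr Z U W vZ' vU vW)).
have s2 := smooth_near_add sM' s1 (sg U W Z vU vW vZ').
have s3 := smooth_near_add sM' s2 (smooth_near_opp sM' (sg U Z W vU vZ' vW)).
exact: (smooth_near_add sM' s3 (smooth_near_opp sM' (sg W Z U vW vZ' vU))).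
Qed.

Lemma koszulDr U W Z Z' p : vsection U -> vsection W -> vsection Z -> vsection Z' ->
  koszul U W (Z + Z') p = koszul U W Z p + koszul U W Z' p.
Proof.
move=> vU vW v v'; have vv := vD v v'; have r := ab_vfield aB.
rewrite /koszul (actgC _ _ vW vv) !actgD ?(ab_anchorD aB) ?fieldDE//; try exact: r.
rewrite (gpairDr _ v v' (vB vU vW)) !BDr// (actgC _ _ v vW) (actgC _ _ v' vW).
ring.
Qed.

(** The derivatives of [f] along [rho U] and [rho W] cancel against the Leibniz terms of [B U Z] and
    [B W Z]. This is the tensoriality required by [musical]. *)
Lemma koszulZr f U W Z p : smooth A' f -> vsection U -> vsection W -> vsection Z ->
  koszul U W (fscale f Z) p = f p * koszul U W Z p.
Proof.
move=> sf vU vW v; have vv := vZ sf v; have r := ab_vfield aB.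
rewrite /koszul (actgC _ _ vW vv) !actgZ ?(ab_anchorZ aB) ?fscaleE//; try exact: r.
rewrite (gpairZr _ sf v (vB vU vW)) !BZr// (actgC _ _ v vW) (gpairC _ v vU) (gpairC _ v vW).
rewrite ?(gpairC p vU v); ring.
Qed.

Lemma koszulDl U U' W Z p : vsection U -> vsection U' -> vsection W -> vsection Z ->
  koszul (U + U') W Z p = koszul U W Z p + koszul U' W Z p.
Proof.
move=> v v' vW vZ'; have vv := vD v v'; have r := ab_vfield aB.
rewrite /koszul (actgC _ _ vZ' vv) !actgD ?(ab_anchorD aB) ?fieldDE//; try exact: r.
rewrite (BC p vv vW vZ') (BC p vv vZ' vW) !BDr//.
rewrite (gpairDr _ v v' (vB vW vZ')) (actgC _ _ v vZ') (actgC _ _ v' vZ').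
rewrite (BC p v vW vZ') (BC p v' vW vZ') (BC p v vZ' vW) (BC p v' vZ' vW).
ring.
Qed.

Lemma koszulZl f U W Z p : smooth A' f -> vsection U -> vsection W -> vsection Z ->
  koszul (fscale f U) W Z p = f p * koszul U W Z p.
Proof.
move=> sf v vW vZ'; have vv := vZ sf v; have r := ab_vfield aB.
rewrite /koszul (actgC _ _ vZ' vv) !actgZ ?(ab_anchorZ aB) ?fscaleE//; try exact: r.
rewrite (BC p vv vW vZ') (BC p vv vZ' vW) !BZr//.
rewrite (gpairZr _ sf v (vB vW vZ')) (actgC _ _ v vZ').
rewrite (BC p v vW vZ') (BC p v vZ' vW).
ring.
Qed.

Lemma koszulDm U W W' Z p : vsection U -> vsection W -> vsection W' -> vsection Z ->
  koszul U (W + W') Z p = koszul U W Z p + koszul U W' Z p.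
Proof.
move=> vU v v' vZ'; have vv := vD v v'; have r := ab_vfield aB.
rewrite /koszul (actgC _ _ vU vv) !actgD ?(ab_anchorD aB) ?fieldDE//; try exact: r.
rewrite (BC p vv vZ' vU) !BDr//.
rewrite (gpairDr _ v v' (vB vU vZ')) (actgC _ _ v vU) (actgC _ _ v' vU).
rewrite (BC p v vZ' vU) (BC p v' vZ' vU).
ring.
Qed.

(** The derivative of [f] along [rho U] arises twice, from the first term and from [B U W]; after
    halving it is the Leibniz term. The derivatives along [rho Z] cancel. *)
Lemma koszulZm f U W Z p : smooth A' f -> vsection U -> vsection W -> vsection Z ->
  koszul U (fscale f W) Z p = f p * koszul U W Z p + 2 * (rho U p f * gpair W Z p).
Proof.
move=> sf vU v vZ'; have vv := vZ sf v; have r := ab_vfield aB.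
rewrite /koszul (actgC _ _ vU vv) !actgZ ?(ab_anchorZ aB) ?fscaleE//; try exact: r.
rewrite (BC p vv vZ' vU) !BZr//.
rewrite (gpairZr _ sf v (vB vU vZ')) (actgC _ _ v vU).
rewrite (BC p v vZ' vU).
ring.
Qed.

(** All terms but the first are antisymmetric in [W] and [Z], taken together. *)
Lemma koszul_metric U W Z p : vsection U -> vsection W -> vsection Z ->
  koszul U W Z p + koszul U Z W p = 2 * rho U p (gpair W Z).
Proof.
move=> vU vW vZ'; rewrite /koszul (actgC _ _ vZ' vW) (actgC _ _ vU vW) (actgC _ _ vU vZ').
by rewrite (BC p vZ' vW vU); ring.
Qed.

(** Apart from the term with [B U W], the formula is symmetric in [U] and [W]. *)
Lemma koszul_torsion U W Z p : vsection U -> vsection W -> vsection Z ->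
  koszul U W Z p - koszul W U Z p = 2 * gpair (B U W) Z p.
Proof.
move=> vU vW vZ'; rewrite /koszul (actgC _ _ vZ' vU) (actgC _ _ vU vW) (actgC _ _ vZ' vW).
by rewrite (BC p vW vU vZ'); ring.
Qed.

Definition koszul_conn U W : field R M' :=
  xget 0 [set V | vsection V /\
    forall Z, vsection Z -> gpair V Z = (fun p => 2^-1 * koszul U W Z p)].

Lemma koszul_connP U W : vsection U -> vsection W -> vsection (koszul_conn U W) /\
  forall Z, vsection Z -> gpair (koszul_conn U W) Z = (fun p => 2^-1 * koszul U W Z p).
Proof.
move=> vU vW.
have [V vV HV] : exists2 V, vsection V & forall Z, vsection Z ->
    gpair V Z = (fun p => 2^-1 * koszul U W Z p).
  apply: musical => [Z vZ' p|Z Z' v v' p|f Z sf v p].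
  - by apply: (smooth_near_mul sM'); [exact: smooth_near_cst|exact: koszul_smooth].
  - by rewrite koszulDr// mulrDr.
  - by rewrite koszulZr// mulrCA.
by apply: (@xgetPex _ 0 [set V | vsection V /\
    forall Z, vsection Z -> gpair V Z = (fun p => 2^-1 * koszul U W Z p)]); exists V.
Qed.

Lemma koszul_conn_vsection U W : vsection U -> vsection W -> vsection (koszul_conn U W).
Proof. by move=> vU vW; have [] := koszul_connP vU vW. Qed.

Lemma koszul_connE U W Z p : vsection U -> vsection W -> vsection Z ->
  gpair (koszul_conn U W) Z p = 2^-1 * koszul U W Z p.
Proof. by move=> vU vW vZ'; have [_ ->] := koszul_connP vU vW. Qed.

Let vC U W := @koszul_conn_vsection U W.

Lemma koszul_connDl U U' W : vsection U -> vsection U' -> vsection W ->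
  koszul_conn (U + U') W = koszul_conn U W + koszul_conn U' W.
Proof.
move=> vU vU' vW; apply: gpair_inj => [||Z vZ'].
- exact/vC/vW/vD.
- by apply: vD; exact: vC.
apply/funext => p; rewrite gpairDl ?koszul_connE ?koszulDl//; try exact: vC; last exact: vD.
by rewrite mulrDr.
Qed.

Lemma koszul_conn0l W : vsection W -> koszul_conn 0 W = 0.
Proof.
move=> vW; have v0 := vsection0 oM'; have := koszul_connDl v0 v0 vW.
by rewrite addr0 => /eqP; rewrite eq_sym -subr_eq0 addrK => /eqP.
Qed.

Lemma koszul_connZl f U W : smooth A' f -> vsection U -> vsection W ->
  koszul_conn (fscale f U) W = fscale f (koszul_conn U W).
Proof.
move=> sf vU vW; apply: gpair_inj => [||Z vZ'].
- exact/vC/vW/vZ.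
- by apply: vZ => //; exact: vC.
apply/funext => p; rewrite gpairZl ?koszul_connE ?koszulZl//; try exact: vC; last exact: vZ.
by rewrite mulrCA.
Qed.

Lemma koszul_connDr U W W' : vsection U -> vsection W -> vsection W' ->
  koszul_conn U (W + W') = koszul_conn U W + koszul_conn U W'.
Proof.
move=> vU vW vW'; apply: gpair_inj => [||Z vZ'].
- by apply: vC => //; exact: vD.
- by apply: vD; exact: vC.
apply/funext => p; rewrite gpairDl ?koszul_connE ?koszulDm//; try exact: vC; last exact: vD.
by rewrite mulrDr.
Qed.

Lemma koszul_conn_leibniz f U W : smooth A' f -> vsection U -> vsection W ->
  koszul_conn U (fscale f W) = fscale f (koszul_conn U W) + fscale (act (rho U) f) W.
Proof.
move=> sf vU vW.
have sa : smooth A' (act (rho U) f).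
  by move=> r; apply: vfield_smooth; [exact: (ab_vfield aB)|exact: sf].
have v1 : vsection (fscale f (koszul_conn U W)) by apply: vZ => //; exact: vC.
have v2 : vsection (fscale (act (rho U) f) W) by apply: vZ.
have v3 : vsection (fscale f W) by exact: vZ.
apply: gpair_inj => [||Z vZ']; [exact: vC|exact: vD|].
apply/funext => p; rewrite gpairDl// gpairZl//; last exact: vC.
rewrite gpairZl// !koszul_connE// koszulZm// /act.
by field.
Qed.

Lemma koszul_conn_metric U W Z p : vsection U -> vsection W -> vsection Z ->
  rho U p (gpair W Z) = gpair (koszul_conn U W) Z p + gpair W (koszul_conn U Z) p.
Proof.
move=> vU vW vZ'; rewrite [gpair W _ _]gpairC//; last exact: vC.
rewrite !koszul_connE// -mulrDr koszul_metric// mulrA mulVf ?mul1r// pnatr_eq0//.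
Qed.

Lemma koszul_conn_torsion U W : vsection U -> vsection W ->
  koszul_conn U W - koszul_conn W U = B U W.
Proof.
move=> vU vW; have v1 := vC vU vW; have v2 := vC vW vU.
apply: gpair_inj => [||Z vZ']; [exact: vsectionB|exact: vB|].
apply/funext => p; rewrite gpairDl//; last exact: vsectionN.
rewrite gpairNl// !koszul_connE// -mulrBr koszul_torsion//.
by rewrite mulrA mulVf ?mul1r// pnatr_eq0.
Qed.

(** Inserting the metric and torsion identities of [C] into [koszul] leaves exactly
    [2 g(C U W, Z)]. *)
Lemma koszul_conn_unique (C : field R M' -> field R M' -> field R M') :
  (forall U W, vsection U -> vsection W -> vsection (C U W)) ->
  (forall U W Z p, vsection U -> vsection W -> vsection Z ->
     rho U p (gpair W Z) = gpair (C U W) Z p + gpair W (C U Z) p) ->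
  (forall U W, vsection U -> vsection W -> C U W - C W U = B U W) ->
  forall U W, vsection U -> vsection W -> C U W = koszul_conn U W.
Proof.
move=> vCC metC torC U W vU vW; apply: gpair_inj => [||Z vZ']; [exact: vCC|exact: vC|].
apply/funext => p; rewrite koszul_connE//.
have tor X Y V : vsection X -> vsection Y -> vsection V ->
    gpair (B X Y) V p = gpair (C X Y) V p - gpair (C Y X) V p.
  move=> vX vY vV; have v1 := vCC _ _ vX vY; have v2 := vCC _ _ vY vX.
  by rewrite -torC// gpairDl ?gpairNl//; exact: vsectionN.
rewrite /koszul !metC// !tor//.
rewrite (gpairC _ vZ' (vCC _ _ vW vU)) (gpairC _ vW (vCC _ _ vU vZ')).
rewrite (gpairC _ vU (vCC _ _ vZ' vW)).
by field.
Qed.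
End Koszul.
End FinslerMetric.

(** * Horizontal vectors and the theorem *)

Section Horizontal.
Context {R : realType} {m : nat} {M : manifold R m} {M' : set (tangent_bundle M)}.
Hypothesis oM' : aopen (tangent_charts M) M'.
Variables (H : M' -> set (vect R M')) (hH : nonlinear_connection H).
Variables (J : M' -> vect R M' -> vect R M') (hJ : associate_acs H J).
Local Notation A' := (sub_charts M').
Implicit Types (a : chart_index A') (p r : M') (U W X Y Z : field R M') (u w : vect R M').

Let sM' : smooth_atlas A' := sub_smooth_atlas oM'.
#[local] Existing Instance sM'.

Lemma H_span p : exists X : 'I_m -> vect R M', (forall i, tangent A' p (X i)) /\
  H p = [set \sum_i (c i \*o X i) | c in [set: 'I_m -> R]].
Proof.
have [ O1 [X [_ Op vX HX]]] := nc_distribution hH p.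
exists (fun i => X i p); split; last by have [] := HX p Op.
by move=> i; have [+ _] := vX i; apply.
Qed.

Lemma H_tangent p u : H p u -> tangent A' p u.
Proof.
have [X [tX ->]] := H_span p; move=> [c _ <-].
exact: (tangent_sum sM').
Qed.

Lemma H_lin p c u w : H p u -> H p w -> H p (c \*o u + w).
Proof.
have [X [tX ->]] := H_span p; move=> [d _ <-] [e _ <-].
exists (fun i => c * d i + e i) => //; apply/funext => f.
rewrite fctE /= !fct_sumE mulr_sumr -big_split /=; apply: eq_bigr => i _.
by rewrite /= mulrDl mulrA.
Qed.

Lemma H0 p : H p 0.
Proof.
have [X [tX ->]] := H_span p; exists (fun=> 0) => //.
by rewrite big1// => i _; apply/funext => f /=; rewrite mul0r.
Qed.

Lemma H_scale p c u : H p u -> H p (c \*o u).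
Proof. by move=> Hu; have := H_lin c Hu (H0 p); rewrite addr0. Qed.

Lemma H_add p u w : H p u -> H p w -> H p (u + w).
Proof.
move=> Hu Hw; have := H_lin 1 Hu Hw; congr (H p _); apply/funext => f.
by rewrite !fctE /= mul1r.
Qed.

Lemma H_opp p u : H p u -> H p (- u).
Proof.
move=> /(H_scale (-1)); congr (H p _); apply/funext => f.
by rewrite /= mulN1r.
Qed.

Lemma H_sum p (I : Type) (s : seq I) (P : pred I) (c : I -> R) (u : I -> vect R M') :
  (forall i, H p (u i)) -> H p (\sum_(i <- s | P i) (c i \*o u i)).
Proof.
move=> Hu; elim/big_ind: _ => [|u' w tu tw|i _]; [exact: H0|exact: H_add|].
exact: H_scale.
Qed.

(** The projection is defined by choice; the sum being direct, exhibiting a horizontal part is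
    enough to compute it. *)
Lemma hproj_uniq p u w : H p u -> vertical p (w - u) -> hproj H p w = u.
Proof.
move=> Hu vu; pose S := [set u | H p u /\ vertical p (w - u)].
have [Hh vh] : S (hproj H p w) by apply: (@xgetPex _ 0 S); exists u.
apply/eqP; rewrite -subr_eq0; apply/eqP; apply: (nc_direct hH (p := p)).
  by apply: H_add => //; exact: H_opp.
have -> : hproj H p w - u = (w - u) - (w - hproj H p w).
  by rewrite opprB [RHS]addrC subrKA.
exact: (vertical_sub oM').
Qed.

Lemma hprojP p w : tangent A' p w -> H p (hproj H p w) /\ vertical p (w - hproj H p w).
Proof.
move=> /(nc_sum hH) [u [u' [Hu vu' ->]]].
by rewrite (@hproj_uniq p u) ?[u + u']addrC ?addrK.
Qed.

Lemma hproj_H p w : tangent A' p w -> H p (hproj H p w).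
Proof. by move=> /hprojP[]. Qed.

Lemma hproj_tangent p w : tangent A' p w -> tangent A' p (hproj H p w).
Proof. by move=> tw; exact/H_tangent/hproj_H. Qed.

Lemma vproj_vertical p w : tangent A' p w -> vertical p (vproj H p w).
Proof. by move=> /hprojP[]. Qed.

Lemma hproj_vertical p w : vertical p w -> hproj H p w = 0.
Proof. by move=> vw; apply: hproj_uniq; [exact: H0|rewrite subr0]. Qed.

Lemma hproj_id p u : H p u -> hproj H p u = u.
Proof. by move=> Hu; apply: hproj_uniq => //; rewrite subrr; exact: vertical0. Qed.

Lemma hproj_lin p c u w : tangent A' p u -> tangent A' p w ->
  hproj H p (c \*o u + w) = c \*o hproj H p u + hproj H p w.
Proof.
move=> /hprojP[Hu vu] /hprojP[Hw vw]; apply: hproj_uniq; first exact: H_lin.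
have := vertical_lin oM' c vu vw; congr vertical; apply/funext => f.
by rewrite !fctE /=; ring.
Qed.

Lemma hproj_add p u w : tangent A' p u -> tangent A' p w ->
  hproj H p (u + w) = hproj H p u + hproj H p w.
Proof.
move=> tu tw; have := hproj_lin 1 tu tw.
have E (x y : vect R M') : 1 \*o x + y = x + y by apply/funext => f; rewrite !fctE /= mul1r.
by rewrite !E.
Qed.

Lemma hproj_scale p c u : tangent A' p u -> hproj H p (c \*o u) = c \*o hproj H p u.
Proof.
move=> tu; have := hproj_lin c tu (tangent0 sM' p).
by rewrite !addr0 (hproj_vertical (vertical0 oM' p)) addr0.
Qed.

Lemma vproj_id p w : vertical p w -> vproj H p w = w.
Proof. by move=> vw; rewrite /vproj hproj_vertical// subr0. Qed.

Lemma vproj_H p w : H p w -> vproj H p w = 0.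
Proof. by move=> Hw; rewrite /vproj hproj_id// subrr. Qed.

Lemma J0 p : J p 0 = 0.
Proof.
have t0 := tangent0 sM' p; have := acs_linear hJ 1 t0 t0.
have E (x y : vect R M') : 1 \*o x + y = x + y by apply/funext => f; rewrite !fctE /= mul1r.
by rewrite !E addr0 => /eqP; rewrite eq_sym -subr_eq0 addrK => /eqP.
Qed.

Lemma J_scale p c u : tangent A' p u -> J p (c \*o u) = c \*o J p u.
Proof. by move=> tu; have := acs_linear hJ c tu (tangent0 sM' p); rewrite J0 !addr0. Qed.

Lemma J_add p u w : tangent A' p u -> tangent A' p w -> J p (u + w) = J p u + J p w.
Proof.
move=> tu tw; have := acs_linear hJ 1 tu tw.
have E (x y : vect R M') : 1 \*o x + y = x + y by apply/funext => f; rewrite !fctE /= mul1r.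
by rewrite !E.
Qed.

Lemma J_opp p u : tangent A' p u -> J p (- u) = - J p u.
Proof.
move=> tu; have := J_scale (-1) tu.
have E (x : vect R M') : -1 \*o x = - x by apply/funext => f; rewrite /= mulN1r.
by rewrite !E.
Qed.

Lemma J_sum p (I : Type) (s : seq I) (c : I -> R) (u : I -> vect R M') :
  (forall i, tangent A' p (u i)) ->
  J p (\sum_(i <- s) (c i \*o u i)) = \sum_(i <- s) (c i \*o J p (u i)).
Proof.
move=> tu; elim: s => [|i s IH]; first by rewrite !big_nil J0.
by rewrite !big_cons (acs_linear hJ) ?IH//; exact: (tangent_sum sM').
Qed.

Lemma delta_H a i p : chart_dom a p -> H p (delta_dx H a i p).
Proof. by move=> dp; apply: hproj_H; exact: (tangent_partial (A := A')). Qed.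

Lemma hproj_expand a p w : chart_dom a p -> tangent A' p w ->
  hproj H p w = \sum_i (w (cfun a (lshift m i)) \*o delta_dx H a i p).
Proof.
move=> dp tw; apply: hproj_uniq; first by apply: H_sum => i; exact: delta_H.
have -> : w - \sum_i (w (cfun a (lshift m i)) \*o delta_dx H a i p) =
    \sum_i (w (cfun a (lshift m i)) \*o vproj H p (d_dx a i p)) +
    \sum_i (w (ycoord a i) \*o d_dy a i p).
  apply/funext => f; rewrite !fctE /= !fct_sumE (tangent_split oM' _ dp tw) addrAC -sumrB.
  congr (_ + _); apply: eq_bigr => i _.
  by rewrite /vproj !fctE /= mulrBr.
apply: (vertical_add oM'); apply: (vertical_sum oM') => i.
  by apply: vproj_vertical; exact: (tangent_partial (A := A')).
exact: vertical_d_dy.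
Qed.

Lemma J_vertical a p w : chart_dom a p -> vertical p w ->
  J p w = \sum_i (w (ycoord a i) \*o delta_dx H a i p).
Proof.
move=> dp vw; rewrite [in LHS](vertical_expand oM' dp vw) J_sum.
  by apply: eq_bigr => i _; rewrite (acs_dy hJ).
by move=> i; exact/vertical_tangent/vertical_d_dy.
Qed.

Lemma J_horizontal a p u : chart_dom a p -> H p u ->
  J p u = \sum_i (u (cfun a (lshift m i)) \*o (- d_dy a i p)).
Proof.
move=> dp Hu; rewrite -[in LHS](hproj_id Hu) (hproj_expand dp (H_tangent Hu)) J_sum.
  by apply: eq_bigr => i _; rewrite (acs_delta hJ).
by move=> i; exact/H_tangent/delta_H.
Qed.

Lemma J_vertical_H p w : vertical p w -> H p (J p w).
Proof.
move=> vw; have [a dp] := atlas_cover sM' p.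
by rewrite (J_vertical dp vw); apply: H_sum => i; exact: delta_H.
Qed.

Lemma J_H_vertical p u : H p u -> vertical p (J p u).
Proof.
move=> Hu; have [a dp] := atlas_cover sM' p.
rewrite (J_horizontal dp Hu); apply: (vertical_sum oM') => i.
by apply: (vertical_opp oM'); exact: vertical_d_dy.
Qed.

(** That [J] squares to -1 is not a clause of [associate_acs]; on each summand it follows from the
    values of [J] on the frame. *)
Lemma JJ_vertical p w : vertical p w -> J p (J p w) = - w.
Proof.
move=> vw; have [a dp] := atlas_cover sM' p.
rewrite (J_vertical dp vw) J_sum; last by move=> i; exact/H_tangent/delta_H.
rewrite [in RHS](vertical_expand oM' dp vw) -sumrN; apply: eq_bigr => i _.
rewrite (acs_delta hJ)//; apply/funext => f.
exact: mulrN.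
Qed.

Lemma JJ_H p u : H p u -> J p (J p u) = - u.
Proof.
move=> Hu; have [a dp] := atlas_cover sM' p.
rewrite (J_horizontal dp Hu) J_sum; last first.
  by move=> i; apply/vertical_tangent/(vertical_opp oM')/vertical_d_dy.
rewrite -[in RHS](hproj_id Hu) (hproj_expand dp (H_tangent Hu)) -sumrN; apply: eq_bigr => i _.
rewrite J_opp; last exact/vertical_tangent/vertical_d_dy.
rewrite (acs_dy hJ)//; apply/funext => f.
exact: mulrN.
Qed.

(** * The projections and [J] on vector fields, and the torsion conditions *)

Local Notation hF := (fibrewise (hproj H)).
Local Notation vF := (fibrewise (vproj H)).
Local Notation JF := (fibrewise J).

(* Where [b = 1], the frame [delta/delta x^i] is the image under [J] of the global sections
   [b d/dy^i]; so the smoothness of [J] gives that of the projection. *)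
Lemma vfield_hF X : vfield A' X -> vfield A' (hF X).
Proof.
move=> vX; split=> [p _|p f _ sf]; first by apply: hproj_tangent; exact: vfield_tangent.
have [a [b B]] := ex_bump oM' p; have [dp _ bp _] := B.
have K : smooth_near A' p (fun r => \sum_i
    act X (cfun a (lshift m i)) r * act (JF (dy_ext a b i)) f r).
  apply: (smooth_near_sum sM') => i _; apply: (smooth_near_mul sM').
    by apply: vfield_smooth => //; exact: cfun_smooth.
  apply: vfield_smooth => //; apply: (acs_smooth hJ); apply: vsection_vfield.
  exact: dy_ext_vsection B.
apply: smooth_near_eq K; apply: filterS (filterI bp (anbhs_dom sM' dp)) => r [br dr].
rewrite /act /fibrewise (hproj_expand dr (vfield_tangent r vX)) fct_sumE.
apply: eq_bigr => i _; congr (_ * _).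
have -> : dy_ext a b i r = d_dy a i r.
  by apply/funext => k; rewrite /dy_ext fscaleE br mul1r.
by rewrite (acs_dy hJ).
Qed.

Lemma vF_vsection X : vfield A' X -> vsection (vF X).
Proof.
move=> vX; split; last by move=> p; apply: vproj_vertical; exact: vfield_tangent.
exact: (vfieldB sM' vX (vfield_hF vX)).
Qed.

Lemma JhF_vsection X : vfield A' X -> vsection (JF (hF X)).
Proof.
move=> vX; split; first by apply: (acs_smooth hJ); exact: vfield_hF.
by move=> p; apply: J_H_vertical; apply: hproj_H; exact: vfield_tangent.
Qed.

Lemma JF_vfield U : vsection U -> vfield A' (JF U).
Proof. by move=> vU; apply: (acs_smooth hJ); exact: vsection_vfield. Qed.

Lemma field_split X : X = vF X + hF X.
Proof. by apply/funext => p; rewrite fctE /fibrewise /vproj subrK. Qed.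

Lemma vF_id U : vsection U -> vF U = U.
Proof. by move=> vU; apply/funext => p; apply: vproj_id; exact: vsection_vertical. Qed.

Lemma hF_vsection U : vsection U -> hF U = 0.
Proof. by move=> vU; apply/funext => p; apply: hproj_vertical; exact: vsection_vertical. Qed.

Lemma JF0 : JF 0 = 0.
Proof. by apply/funext => p; exact: J0. Qed.

Lemma hF_idem X : vfield A' X -> hF (hF X) = hF X.
Proof. by move=> vX; apply/funext => p; apply/hproj_id/hproj_H; exact: vfield_tangent. Qed.

Lemma vhF X : vfield A' X -> vF (hF X) = 0.
Proof. by move=> vX; apply/funext => p; apply/vproj_H/hproj_H; exact: vfield_tangent. Qed.

Lemma JFD X Y : vfield A' X -> vfield A' Y -> JF (X + Y) = JF X + JF Y.
Proof. by move=> vX vY; apply/funext => p; apply: J_add; exact: vfield_tangent. Qed.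

Lemma JFN X : vfield A' X -> JF (- X) = - JF X.
Proof. by move=> vX; apply/funext => p; apply: J_opp; exact: vfield_tangent. Qed.

Lemma JFZ f X : vfield A' X -> JF (fscale f X) = fscale f (JF X).
Proof. by move=> vX; apply/funext => p; apply: J_scale; exact: vfield_tangent. Qed.

Lemma hFD X Y : vfield A' X -> vfield A' Y -> hF (X + Y) = hF X + hF Y.
Proof. by move=> vX vY; apply/funext => p; apply: hproj_add; exact: vfield_tangent. Qed.

Lemma hFZ f X : vfield A' X -> hF (fscale f X) = fscale f (hF X).
Proof. by move=> vX; apply/funext => p; apply: hproj_scale; exact: vfield_tangent. Qed.

Lemma JJhF X : vfield A' X -> JF (JF (hF X)) = - hF X.
Proof. by move=> vX; apply/funext => p; apply/JJ_H/hproj_H; exact: vfield_tangent. Qed.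

Lemma JJF U : vsection U -> JF (JF U) = - U.
Proof. by move=> vU; apply/funext => p; apply: JJ_vertical; exact: vsection_vertical. Qed.

Lemma hJF U : vsection U -> hF (JF U) = JF U.
Proof. by move=> vU; apply/funext => p; apply/hproj_id/J_vertical_H; exact: vsection_vertical. Qed.

Lemma hFN X : vfield A' X -> hF (- X) = - hF X.
Proof.
move=> vX; have E Y : - Y = fscale (fun=> -1) Y.
  by apply/funext => r; apply/funext => f; rewrite fscaleE fieldNE mulN1r.
by rewrite E hFZ// -E.
Qed.

(** Integrability of [VM']: both fields annihilate the coordinates [x^i] near [p], hence so does
    their bracket. *)
Lemma bracket_vsection U W : vsection U -> vsection W -> vsection (bracket A' U W).
Proof.
move=> vU vW; have fU := vsection_vfield vU; have fW := vsection_vfield vW.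
split; first exact: vfield_bracket.
move=> p; have [a dp] := atlas_cover sM' p; apply/(verticalP oM' _ dp); split.
  exact: bracket_tangent.
move=> i; rewrite bracketE; last exact: cfun_smooth.
have V X : vsection X -> anbhs A' p (fun r => act X (cfun a (lshift m i)) r = 0).
  move=> vX; apply: filterS (anbhs_dom sM' dp) => r dr.
  by have [_] := proj1 (verticalP oM' _ dr) (vsection_vertical r vX); exact.
have tU := vfield_tangent p fU; have tW := vfield_tangent p fW.
rewrite (tangent_eq sM' tU (V W vW)) (tangent_eq sM' tW (V U vU)).
by rewrite (tangent_cst sM' 0 tU) (tangent_cst sM' 0 tW) subrr.
Qed.

Lemma fscaleDr f X Y : fscale f (X + Y) = fscale f X + fscale f Y.
Proof. by apply/funext => p; apply/funext => k; rewrite fscaleE !fieldDE !fscaleE mulrDr. Qed.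

Lemma fscaleNr f X : fscale f (- X) = - fscale f X.
Proof. by apply/funext => p; apply/funext => k; rewrite fscaleE !fieldNE fscaleE mulrN. Qed.

Lemma vF_add X Y : vfield A' X -> vfield A' Y -> vF (X + Y) = vF X + vF Y.
Proof.
move=> vX vY; apply/funext => p; rewrite /fibrewise /vproj [(X + Y) p]/(X p + Y p).
rewrite hproj_add; try exact: vfield_tangent.
by rewrite opprD addrACA.
Qed.

Lemma vF_scale f X : vfield A' X -> vF (fscale f X) = fscale f (vF X).
Proof.
move=> vX; apply/funext => p; rewrite /fibrewise /vproj [fscale f X p]/(f p \*o X p).
rewrite hproj_scale; last exact: vfield_tangent.
by apply/funext => k; rewrite fscaleE !fctE /= mulrBr.
Qed.

(** On horizontal vectors [- J] inverts [J], so the second term is the horizontal part of [[JU, JW]]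
    carried back to [VM']. The vertical part, the curvature of [HM'], is dropped. *)
Definition curvature_bracket (T : field R M' -> field R M' -> field R M') U W :=
  T U W - JF (hF (bracket A' (JF U) (JF W))).

Lemma linear_connection0 nabla X : linear_connection nabla -> vfield A' X -> nabla X 0 = 0.
Proof.
move=> ln vX; have := lc_add_r ln vX (vsection0 oM') (vsection0 oM').
by rewrite addr0 => /eqP; rewrite eq_sym -subr_eq0 addrK => /eqP.
Qed.

Lemma Dconn_vertical nabla X W : linear_connection nabla -> vfield A' X -> vsection W ->
  Dconn H J nabla X W = nabla X W.
Proof.
move=> ln vX vW; rewrite /Dconn vF_id// hF_vsection// JF0 linear_connection0//.
by rewrite JF0 subr0.
Qed.

(** On [HM'] the connection [D] is [nabla] conjugated by [J], as [- J] is the inverse of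
    [J : HM' -> VM']. *)
Lemma Dconn_horizontal nabla X Y : linear_connection nabla -> vfield A' X -> vfield A' Y ->
  Dconn H J nabla X (hF Y) = - JF (nabla X (JF (hF Y))).
Proof.
by move=> ln vX vY; rewrite /Dconn vhF// hF_idem// linear_connection0// sub0r.
Qed.

Lemma torsion_vertical nabla U W : linear_connection nabla -> vsection U -> vsection W ->
  torsion (Dconn H J nabla) U W = nabla U W - nabla W U - bracket A' U W.
Proof.
by move=> ln vU vW; rewrite /torsion !Dconn_vertical//; exact: vsection_vfield.
Qed.

Lemma hF_torsion nabla X Y : linear_connection nabla -> vfield A' X -> vfield A' Y ->
  hF (torsion (Dconn H J nabla) (hF X) (hF Y)) =
  JF (nabla (hF Y) (JF (hF X)) - nabla (hF X) (JF (hF Y)))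
    - hF (bracket A' (hF X) (hF Y)).
Proof.
move=> ln vX vY; have vhX := vfield_hF vX; have vhY := vfield_hF vY.
have v1 := lc_vsection ln vhX (JhF_vsection vY).
have v2 := lc_vsection ln vhY (JhF_vsection vX).
have vb := vfield_bracket sM' vhX vhY.
rewrite /torsion !Dconn_horizontal// opprK [- _ + _]addrC.
rewrite -[- JF _](JFN (vsection_vfield v1)) -JFD;
  [|exact: vsection_vfield|exact/vfieldN/vsection_vfield].
rewrite hFD; [|exact/JF_vfield/(vsectionB oM')|exact: vfieldN].
by rewrite hFN// hJF//; exact: vsectionB.
Qed.

(** Condition (b) carried to [VM']: since [J] is injective on vertical and on horizontal fields,
    applying it to the equation loses nothing. *)
Lemma hF_torsion_J nabla T U W : linear_connection nabla -> skew_finsler_tensor T ->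
  vsection U -> vsection W ->
  hF (torsion (Dconn H J nabla) (JF U) (JF W)) = JF (T (JF (JF U)) (JF (JF W))) <->
  nabla (JF U) W - nabla (JF W) U = curvature_bracket T U W.
Proof.
move=> ln tT vU vW; have vJU := JF_vfield vU; have vJW := JF_vfield vW.
have EN Y : - Y = fscale (fun=> -1) Y.
  by apply/funext => r; apply/funext => f; rewrite fscaleE fieldNE mulN1r.
have sN : smooth A' (fun=> -1) by move=> r; exact: smooth_near_cst.
have nN X Y : vfield A' X -> vsection Y -> nabla X (- Y) = - nabla X Y.
  move=> vX vY; apply/eqP; rewrite -addr_eq0 -(lc_add_r ln)//; last exact: vsectionN.
  by rewrite addNr linear_connection0.
(* Each [JJ] is a sign, and the two signs cancel by bilinearity. *)
have E : T (JF (JF U)) (JF (JF W)) = T U W.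
  rewrite !JJF// (EN U) (ft_scale_l tT)//; last exact: vsectionN.
  by rewrite (EN W) (ft_scale_r tT)// -!EN opprK.
have := hF_torsion ln vJU vJW; rewrite E !hJF// => ->.
rewrite !JJF// !nN// opprK [- _ + _]addrC /curvature_bracket.
set N := nabla (JF U) W - nabla (JF W) U; set t := T U W; set b := bracket _ _ _.
have vNs : vsection N by apply: (vsectionB oM'); exact: (lc_vsection ln).
have vN := vsection_vfield vNs.
have vt : vsection t by exact: (ft_vsection tT).
have vb : vfield A' b by exact: vfield_bracket.
have vhb := vfield_hF vb; have vJhb := JhF_vsection vb; have vJt := JF_vfield vt.
split=> [/eqP|->].
  rewrite subr_eq => /eqP/(congr1 JF); rewrite JJF// JFD// JJF// => /(congr1 -%R).
  by rewrite opprK opprD opprK.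
rewrite JFD; [|exact: vsection_vfield|exact/vfieldN/vsection_vfield].
rewrite JFN; last exact: vsection_vfield.
by rewrite JJhF// opprK addrK.
Qed.

Lemma anchored_vertical S : skew_finsler_tensor S ->
  anchored_bracket id (fun U W => bracket A' U W + S U W).
Proof.
move=> tS; split=> //.
- by move=> U; exact: vsection_vfield.
- move=> U W vU vW; apply: (vsectionD oM'); first exact: bracket_vsection.
  exact: (ft_vsection tS).
- by move=> U W vU vW; rewrite bracketC (ft_skew tS)// opprD.
- move=> U W Z vU vW vZ; rewrite (ft_add_r tS)// bracketDr; try exact: vsection_vfield.
  by rewrite addrACA.
- move=> f U W sf vU vW; rewrite (ft_scale_r tS)// bracketZr//; try exact: vsection_vfield.
  by rewrite fscaleDr addrAC.
Qed.

Lemma anchored_horizontal T : skew_finsler_tensor T ->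
  anchored_bracket JF (curvature_bracket T).
Proof.
move=> tT.
have vb U W : vsection U -> vsection W -> vfield A' (bracket A' (JF U) (JF W)).
  by move=> vU vW; apply: vfield_bracket; exact: JF_vfield.
split.
- exact: JF_vfield.
- by move=> U W vU vW; apply: JFD; exact: vsection_vfield.
- by move=> f U sf vU; apply: JFZ; exact: vsection_vfield.
- move=> U W vU vW; apply: (vsectionB oM'); first exact: (ft_vsection tT).
  exact/JhF_vsection/vb.
- move=> U W vU vW; rewrite /curvature_bracket (ft_skew tT)// bracketC.
  rewrite hFN; last exact: vb.
  rewrite JFN; last exact/vfield_hF/vb.
  by rewrite opprD.
- move=> U W Z vU vW vZ; rewrite /curvature_bracket (ft_add_r tT)//.
  rewrite JFD; try exact: vsection_vfield.
  rewrite bracketDr; try exact: JF_vfield.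
  rewrite hFD; try exact: vb.
  rewrite JFD; try exact/vfield_hF/vb.
  by rewrite opprD addrACA.
- move=> f U W sf vU vW; rewrite /curvature_bracket (ft_scale_r tT)//.
  rewrite JFZ; last exact: vsection_vfield.
  rewrite bracketZr//; try exact: JF_vfield.
  have sa : smooth A' (act (JF U) f).
    by move=> r; apply: vfield_smooth; [exact: JF_vfield|exact: sf].
  have v1 : vfield A' (fscale f (bracket A' (JF U) (JF W))) by apply: vfieldZ => //; exact: vb.
  have v2 : vfield A' (fscale (act (JF U) f) (JF W)) by apply: vfieldZ => //; exact: JF_vfield.
  rewrite hFD// JFD; try exact: vfield_hF.
  rewrite hFZ; last exact: vb.
  rewrite JFZ; last exact/vfield_hF/vb.
  rewrite hFZ ?hJF//; last exact: JF_vfield.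
  rewrite JFZ; last exact: JF_vfield.
  (* The bracket contributes the Leibniz term [(JU f) JW]; [- J] sends it to [(JU f) W], the Leibniz
     term for the anchor [J]. *)
  by rewrite JJF// fscaleNr opprD opprK fscaleDr fscaleNr addrA.
Qed.
End Horizontal.

(** Uniqueness is equality on genuine vector fields and sections: the values of the operators
    elsewhere are unconstrained. *)
Theorem theorem2 (R : realType) (m q : nat) (M : manifold R m)
  (M' : set (tangent_bundle M)) (F : M' -> R) (hF : pseudo_finsler q F)
  (g : M' -> vect R M' -> vect R M' -> R) (hg : vertical_metric F g)
  (H : M' -> set (vect R M')) (hH : nonlinear_connection H)
  (J : M' -> vect R M' -> vect R M') (hJ : associate_acs H J)
  (S T : field R M' -> field R M' -> field R M')
  (hS : skew_finsler_tensor S) (hT : skew_finsler_tensor T) :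
  let h := fibrewise (hproj H) in
  let v := fibrewise (vproj H) in
  let conditions (nabla : field R M' -> field R M' -> field R M') :=
    let TD := torsion (Dconn H J nabla) in
    [/\ linear_connection nabla,
        metric_connection g nabla,
        (forall X Y, vfield (sub_charts M') X -> vfield (sub_charts M') Y ->
          TD (v X) (v Y) = S (v X) (v Y)) &
        (forall X Y, vfield (sub_charts M') X -> vfield (sub_charts M') Y ->
          h (TD (h X) (h Y)) =
          fibrewise J (T (fibrewise J (h X)) (fibrewise J (h Y))))] in
  (exists nabla, conditions nabla) /\
  (forall nabla nabla', conditions nabla -> conditions nabla' ->
    forall X U, vfield (sub_charts M') X -> vsection U ->
      nabla X U = nabla' X U).
Proof.
move=> h v conditions.
have oM' := pf_open hF; have sM' := sub_smooth_atlas oM'.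
pose B1 U W := bracket (sub_charts M') U W + S U W.
pose B2 := curvature_bracket H J T.
have aB1 : anchored_bracket id B1 := anchored_vertical oM' hS.
have aB2 : anchored_bracket (fibrewise J) B2 := anchored_horizontal oM' hH hJ hT.
pose D1 := koszul_conn g id B1.
pose D2 := koszul_conn g (fibrewise J) B2.
have D1v := koszul_conn_vsection hF hg aB1.
have D2v := koszul_conn_vsection hF hg aB2.
pose k X := - fibrewise J (h X).
have vk X : vfield (sub_charts M') X -> vsection (k X).
  by move=> vX; apply: (vsectionN oM'); exact: (JhF_vsection oM' hH hJ).
have vJ U : vsection U -> vfield (sub_charts M') (fibrewise J U) by exact: (JF_vfield hJ).
have vh X : vfield (sub_charts M') X -> vfield (sub_charts M') (h X).
  exact: (vfield_hF oM' hH hJ).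
have vv X : vfield (sub_charts M') X -> vsection (v X) by move=> vX; exact: (vF_vsection oM' hH hJ).
have Jk X : vfield (sub_charts M') X -> fibrewise J (k X) = h X.
  move=> vX; rewrite (JFN oM' hJ); last exact/vsection_vfield/(JhF_vsection oM' hH hJ).
  by rewrite (JJhF oM' hH hJ vX) opprK.
have kD X Y : vfield (sub_charts M') X -> vfield (sub_charts M') Y -> k (X + Y) = k X + k Y.
  move=> vX vY; rewrite /k /h (hFD oM' hH)// (JFD hJ) ?opprD//; exact: vh.
have kZ f X : smooth (sub_charts M') f -> vfield (sub_charts M') X -> k (fscale f X) = fscale f (k X).
  move=> sf vX; rewrite /k /h (hFZ oM' hH)// (JFZ oM' hJ) ?fscaleNr//; exact: vh.
have k_vert U : vsection U -> k U = 0.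
  by move=> vU; rewrite /k /h (hF_vsection oM' hH vU) (JF0 oM' hJ) oppr0.
have kJ U : vsection U -> k (fibrewise J U) = U.
  by move=> vU; rewrite /k /h (hJF oM' hH hJ vU) (JJF oM' hH hJ vU) opprK.
have v_vert U : vsection U -> v U = U by move=> vU; exact: (vF_id oM' hH).
have v_hor U : vsection U -> v (fibrewise J U) = 0.
  move=> vU; rewrite /v -(hJF oM' hH hJ vU); apply: (vhF oM' hH); exact: vJ.
split; last first.
  (* Along vertical directions, and along horizontal ones reached through [J], [nabla] is pinned
     down by [koszul_conn_unique]; additivity in the direction does the rest. *)
  have key nabla : conditions nabla -> forall X U, vfield (sub_charts M') X -> vsection U ->
      nabla X U = D1 (v X) U + D2 (k X) U.
    move=> [ln mn tv th].
    have C1 := koszul_conn_unique hF hg aB1 (C := nabla).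
    have C2 := koszul_conn_unique hF hg aB2 (C := fun U W => nabla (fibrewise J U) W).
    have met X U W p : vfield (sub_charts M') X -> vsection U -> vsection W ->
        X p (gpair g U W) = gpair g (nabla X U) W p + gpair g U (nabla X W) p.
      move=> vX vU vW; have := mn X U W vX vU vW p.
      by rewrite /nabla_metric => /eqP; rewrite -addrA -opprD subr_eq0 => /eqP.
    move=> X U vX vU; rewrite [X in nabla X](field_split H X).
    rewrite (lc_add_l ln)//; [|exact/vsection_vfield/vv|exact: vh].
    congr (_ + _).
      apply: C1 => //; [| | |exact: vv].
      - by move=> Y W vY vW; apply: (lc_vsection ln) => //; exact: vsection_vfield.
      - by move=> Y W Z p vY vW vZ; apply: met => //; exact: vsection_vfield.
      - move=> Y W vY vW.
        have := tv Y W (vsection_vfield vY) (vsection_vfield vW).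
        rewrite /v !(vF_id oM' hH)// (torsion_vertical oM' hH hJ ln vY vW).
        by rewrite /B1 => <-; rewrite [RHS]addrC subrK.
    rewrite -[fibrewise (hproj H) X](Jk X vX).
    apply: C2 => //; [| | |exact: vk].
    - by move=> Y W vY vW; apply: (lc_vsection ln) => //; exact: vJ.
    - by move=> Y W Z p vY vW vZ; apply: met => //; exact: vJ.
    - move=> Y W vY vW.
      have vJY := JF_vfield hJ vY; have vJW := JF_vfield hJ vW.
      apply: (proj1 (hF_torsion_J oM' hH hJ ln hT vY vW)).
      (* The fields [J Y] and [J W] are already horizontal, so (b) applies to them as they stand. *)
      by have := th _ _ vJY vJW; rewrite /h !(hJF oM' hH hJ).
  by move=> nabla nabla' cn cn' X U vX vU; rewrite (key nabla)// (key nabla').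
pose nabla X U := D1 (v X) U + D2 (k X) U.
exists nabla.
have ln : linear_connection nabla.
  split.
  - by move=> X U vX vU; apply: (vsectionD oM'); [apply: D1v|apply: D2v] => //; [exact: vv|exact: vk].
  - move=> X Y U vX vY vU; rewrite /nabla /v (vF_add oM' hH)// kD//.
    rewrite /D1 (koszul_connDl hF hg aB1)//; try exact: vv.
    rewrite /D2 (koszul_connDl hF hg aB2)//; try exact: vk.
    by rewrite addrACA.
  - move=> f X U sf vX vU; rewrite /nabla /v (vF_scale oM' hH)// kZ//.
    rewrite /D1 (koszul_connZl hF hg aB1)//; last exact: vv.
    rewrite /D2 (koszul_connZl hF hg aB2)//; last exact: vk.
    by rewrite fscaleDr.
  - move=> X U W vX vU vW; rewrite /nabla.
    rewrite /D1 (koszul_connDr hF hg aB1)//; last exact: vv.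
    rewrite /D2 (koszul_connDr hF hg aB2)//; last exact: vk.
    by rewrite addrACA.
  - move=> f X U sf vX vU; rewrite /nabla.
    rewrite /D1 (koszul_conn_leibniz hF hg aB1)//; last exact: vv.
    rewrite /D2 (koszul_conn_leibniz hF hg aB2)//; last exact: vk.
    (* The two Leibniz terms differentiate along [v X] and [J (k X) = h X], which add up to [X]. *)
    rewrite Jk// addrACA -fscaleDr; congr (_ + _).
    rewrite [in RHS](field_split H X).
    by apply/funext => p; apply/funext => f'; rewrite fieldDE !fscaleE -mulrDl.
split => //.
- move=> X U W vX vU vW p; rewrite /nabla_metric.
  have vvX := vv _ vX; have vkX := vk _ vX.
  have -> : X p (fun q => g q (U q) (W q)) = v X p (gpair g U W) + h X p (gpair g U W).
    have := congr1 (fun Y : field R M' => Y p (gpair g U W)) (field_split H X).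
    by rewrite fieldDE.
  have -> : g p (nabla X U p) (W p) = gpair g (D1 (v X) U) W p + gpair g (D2 (k X) U) W p.
    by rewrite -(gpairDl hg)//; [exact: D1v|exact: D2v].
  have -> : g p (U p) (nabla X W p) = gpair g U (D1 (v X) W) p + gpair g U (D2 (k X) W) p.
    by rewrite -(gpairDr hF hg)//; [exact: D1v|exact: D2v].
  rewrite (koszul_conn_metric hF hg aB1 p vvX vU vW).
  rewrite -(Jk X vX) (koszul_conn_metric hF hg aB2 p vkX vU vW) /D1 /D2.
  ring.
- move=> X Y vX vY; have vX' := vv _ vX; have vY' := vv _ vY.
  rewrite (torsion_vertical oM' hH hJ ln vX' vY') /nabla.
  (* On vertical fields [k] vanishes, so (a) sees [D1] only. *)
  rewrite (v_vert _ vX') (v_vert _ vY') (k_vert _ vX') (k_vert _ vY').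
  rewrite /D2 !(koszul_conn0l hF hg aB2)// !addr0.
  by rewrite (koszul_conn_torsion hF hg aB1 vX' vY') /B1 addrC addKr.
- move=> X Y vX vY; have vkX := vk _ vX; have vkY := vk _ vY.
  rewrite -(Jk X vX) -(Jk Y vY); apply: (proj2 (hF_torsion_J oM' hH hJ ln hT vkX vkY)).
  have vJX := JF_vfield hJ vkX; have vJY := JF_vfield hJ vkY.
  (* On fields [J U] with [U] vertical, [v] vanishes and [k] returns [U], so (b) sees [D2] only. *)
  rewrite /nabla (v_hor _ vkX) (v_hor _ vkY) (kJ _ vkX) (kJ _ vkY).
  rewrite -/B2 -(koszul_conn_torsion hF hg aB2 vkX vkY).
  by rewrite /D1 !(koszul_conn0l hF hg aB1)// !add0r.
Qed.
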